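(* Let $\Omega \subset \mathbb{R}^d$ be bounded and let $k(x,z) = \Phi(x-z)$ be a translational invariant kernel on $\mathbb{R}^d$ whose Fourier transform satisfies, for some $\tau > d/2$ and constants $c_\Phi, C_\Phi > 0$, $$c_\Phi (1+\|\omega\|^2)^{-\tau} \le \hat\Phi(\omega) \le C_\Phi (1+\|\omega\|^2)^{-\tau} \qquad \text{for all } \omega \in \mathbb{R}^d .$$ Then there is a constant $c > 0$, depending only on $\tau, d, k, \Omega$, such that for any finite set $X \subset \Omega$ of pairwise distinct points and any $0 \ne b \in \mathbb{R}^d$ with $\|b\| < c \cdot q_X$, it holds for all $0 \ne \alpha \in \mathbb{R}^{|X|}$: $$\frac34 \cdot \frac{\langle k(X,X)\alpha,\alpha\rangle}{\|\alpha\|^2} \;\le\; \frac{\langle k(X+b,X)_+\,\alpha,\alpha\rangle}{\|\alpha\|^2} \;<\; \frac{\langle k(X,X)\alpha,\alpha\rangle}{\|\alpha\|^2} .$$ If $\tau > 1$, this can be specialized to $$\frac{\langle k(X,X)\alpha,\alpha\rangle}{\|\alpha\|^2} - \Big(\frac{\langle k(X,X)\alpha,\alpha\rangle}{\|\alpha\|^2}\Big)^{1-1/\tau} q_X^{2-d/\tau} \;\le\; \frac{\langle k(X+b,X)_+\,\alpha,\alpha\rangle}{\|\alpha\|^2} \;<\; \frac{\langle k(X,X)\alpha,\alpha\rangle}{\|\alpha\|^2} .$$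
   Context: $\|\cdot\|$ and $\langle\cdot,\cdot\rangle$ are the Euclidean norm and inner product. A translational invariant kernel is a symmetric function $k:\mathbb{R}^d\times\mathbb{R}^d\to\mathbb{R}$ of the form $k(x,z)=\Phi(x-z)$ with $\Phi:\mathbb{R}^d\to\mathbb{R}$; the Fourier transform $\hat\Phi:\mathbb{R}^d\to\mathbb{R}$ is normalized so that $\Phi(x-z) = (2\pi)^{-d/2}\int_{\mathbb{R}^d}\hat\Phi(\omega)e^{i\omega^\top(x-z)}\,d\omega$ for all $x,z$. For $X=\{x_1,\dots,x_n\}$ (pairwise distinct, $n\ge2$) the separation distance is $q_X := \frac12\min_{x_i\neq x_j\in X}\|x_i-x_j\|$. Kernel matrices: $k(X,X) := (k(x_i,x_j))_{1\le i,j\le n}$ and, for $b\in\mathbb{R}^d$, $k(X+b,X) := (k(x_i+b,x_j))_{1\le i,j\le n}$. For a square matrix $A\in\mathbb{R}^{n\times n}$, $A_+ := \frac12(A+A^\top)$ denotes its symmetric part. *)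

(* Defs.v *)
From HB Require Import structures.
From mathcomp Require Import all_boot all_order all_algebra.
From mathcomp Require Import all_classical all_reals all_analysis.
From mathcomp Require Import complex.

Set Implicit Arguments.
Unset Strict Implicit.
Unset Printing Implicit Defensive.

Import Order.TTheory GRing.Theory Num.Theory.
Import numFieldNormedType.Exports.

Local Open Scope classical_set_scope.
Local Open Scope ring_scope.

(* The library has no Lebesgue measure in dimension n.  It is built on
   [n.-tuple R] by iterating binary products, each one transported along the
   bijection [(x, t) |-> x :: t]; [lebesgue_tuple_box] characterizes it. *)
Section lebesgue_cons.
Context (R : realType) (n : nat).
Local Notation T := (measurableTypeR R).

Definition tcons (p : T * n.-tuple T) : n.+1.-tuple T := [tuple of p.1 :: p.2].

Lemma measurable_tcons : measurable_fun [set: T * n.-tuple T] tcons.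
Proof. exact: measurable_cons. Qed.

Variable mu : {sigma_finite_measure set (n.-tuple T) -> \bar R}.

Definition lebesgue_cons : set (n.+1.-tuple T) -> \bar R :=
  pushforward (@lebesgue_measure R \x mu)%E tcons.

Let lebesgue_cons0 : lebesgue_cons set0 = 0%E.
Proof. by rewrite /lebesgue_cons /pushforward preimage_set0 measure0. Qed.

Let lebesgue_cons_ge0 A : (0 <= lebesgue_cons A)%E.
Proof. by rewrite /lebesgue_cons /pushforward; apply: measure_ge0. Qed.

Let lebesgue_cons_sigma_additive : semi_sigma_additive lebesgue_cons.
Proof. by apply: measure_semi_sigma_additive; exact: measurable_tcons. Qed.

HB.instance Definition _ := isMeasure.Build _ _ _ lebesgue_cons
  lebesgue_cons0 lebesgue_cons_ge0 lebesgue_cons_sigma_additive.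

Let lebesgue_cons_sigma_finite : sigma_finite setT lebesgue_cons.
Proof.
have /sigma_finiteP[F [TF ndF Foo]] := sigma_finiteT (@lebesgue_measure R).
have /sigma_finiteP[G [TG ndG Goo]] := sigma_finiteT mu.
pose uncons (t : n.+1.-tuple T) : T * n.-tuple T :=
  (thead t, [tuple of behead t]).
have muncons : measurable_fun setT uncons.
  apply: measurable_fun_pair; [exact: measurable_tnth|exact: measurable_behead].
exists (fun i => uncons @^-1` (F i `*` G i)).
  rewrite -preimage_bigcup; apply/esym/seteqP; split => // t _.
  have : setT (thead t) by [].
  rewrite TF => -[i _ Fi].
  have : setT [tuple of behead t] by [].
  rewrite TG => -[j _ Gj].
  exists (maxn i j) => //; split.
    by move: Fi; exact/subsetPset/ndF/leq_maxl.
  by move: Gj; exact/subsetPset/ndG/leq_maxr.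
move=> i; have [mFi Fi] := Foo i; have [mGi Gi] := Goo i; split.
  by rewrite -[X in measurable X]setTI; apply: muncons => //; exact: measurableX.
rewrite /lebesgue_cons /pushforward -comp_preimage.
rewrite (_ : uncons \o tcons = id) ?preimage_id; last first.
  by apply/funext => -[x t] /=; congr pair; exact: val_inj.
by rewrite product_measure1E// lte_mul_pinfty// ge0_fin_numE.
Qed.

HB.instance Definition _ :=
  Measure_isSigmaFinite.Build _ _ _ lebesgue_cons lebesgue_cons_sigma_finite.

End lebesgue_cons.

Fixpoint lebesgue_tuple (R : realType) (n : nat) :
    {sigma_finite_measure set (n.-tuple (measurableTypeR R)) -> \bar R} :=
  if n is m.+1 then lebesgue_cons (lebesgue_tuple R m) else dirac [tuple].

Lemma lebesgue_tuple_box (R : realType) (n : nat)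
    (A : 'I_n -> set (measurableTypeR R)) :
  (forall i, measurable (A i)) ->
  lebesgue_tuple R n [set t | forall i, A i (tnth t i)] =
  (\prod_(i < n) lebesgue_measure (A i))%E.
Proof.
elim: n A => [|n IH] A mA.
  rewrite big_ord0 /= diracE mem_set//=; by case.
have mB : measurable [set t : n.-tuple (measurableTypeR R) |
    forall i, A (lift ord0 i) (tnth t i)].
  rewrite (_ : [set _ | _] = \bigcap_(i in [set: 'I_n])
      ((fun t : n.-tuple (measurableTypeR R) => tnth t i) @^-1`
         A (lift ord0 i))).
    apply: fin_bigcap_measurable => // i _.
    by rewrite -[X in measurable X]setTI; exact: measurable_tnth.
  by apply/seteqP; split => t /= At i; [move=> _|]; exact: At.
rewrite big_ord_recl -IH// -product_measure1E//.
rewrite /= /lebesgue_cons /pushforward; congr product_measure1.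
apply/seteqP; split => -[x t] /=.
  move=> At; split; first by have := At ord0; rewrite tnth0.
  by move=> i; have := At (lift ord0 i); rewrite tnthS.
by move=> [A0 At] i; case: (unliftP ord0 i) => [j|] ->; rewrite ?tnthS ?tnth0.
Qed.

Section euclidean.
Context (R : realType).

Definition dotv n (u v : 'cV[R]_n) : R := \sum_(i < n) u i 0 * v i 0.

(* Not [`|u|], which on matrices is the maximum norm. *)
Definition enorm n (u : 'cV[R]_n) : R := Num.sqrt (dotv u u).

Definition ebounded d (Omega : set 'cV[R]_d) : Prop :=
  exists M : R, forall x, Omega x -> enorm x <= M.

(* For distinct points and [2 <= n] the set of distances is finite and nonempty,
   so that [inf] is its minimum. *)
Definition separation_distance d n (x : 'I_n -> 'cV[R]_d) : R :=
  2^-1 * inf [set r | exists i j, x i != x j /\ r = enorm (x i - x j)].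

Definition kernel_matrix d n (k : 'cV[R]_d -> 'cV[R]_d -> R)
    (x y : 'I_n -> 'cV[R]_d) : 'M[R]_n := \matrix_(i, j) k (x i) (y j).

Definition symmetric_part n (A : 'M[R]_n) : 'M[R]_n := 2^-1 *: (A + A^T).

Definition rayleigh n (A : 'M[R]_n) (alpha : 'cV[R]_n) : R :=
  dotv (A *m alpha) alpha / enorm alpha ^+ 2.

Definition translational_invariant d (k : 'cV[R]_d -> 'cV[R]_d -> R)
    (Phi : 'cV[R]_d -> R) : Prop :=
  (forall x z, k x z = k z x) /\ (forall x z, k x z = Phi (x - z)).

End euclidean.

Section fourier.
Context (R : realType).
Local Open Scope complex_scope.

Definition expi (t : R) : R[i] := cos t +i* sin t.

Definition col_of_tuple d (t : d.-tuple (measurableTypeR R)) : 'cV[R]_d :=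
  \col_i tnth t i.

Definition integrable_Rd d (f : 'cV[R]_d -> R) : Prop :=
  (lebesgue_tuple R d).-integrable setT (EFin \o f \o @col_of_tuple d).

Definition integral_Rd d (f : 'cV[R]_d -> R) : R :=
  \int[lebesgue_tuple R d]_t f (col_of_tuple t).

Definition cintegral_Rd d (f : 'cV[R]_d -> R[i]) : R[i] :=
  integral_Rd (fun w => complex.Re (f w)) +i*
  integral_Rd (fun w => complex.Im (f w)).

(* [Phihat] is the Fourier transform of [Phi] in the sense of the inversion
   formula.  Integrability (which includes measurability) makes the total
   integral operator meaningful. *)
Definition fourier_transform d (Phi Phihat : 'cV[R]_d -> R) : Prop :=
  integrable_Rd Phihat /\
  forall x z : 'cV[R]_d,
    (Phi (x - z))%:C =
    ((2 * pi) `^ (- (d%:R / 2)))%:C *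
    cintegral_Rd (fun w => (Phihat w)%:C * expi (dotv w (x - z))).

End fourier.

(* Main.v *)
Require Import Defs.
From mathcomp Require Import all_boot all_order all_algebra.
From mathcomp Require Import all_classical all_reals all_analysis.
From mathcomp Require Import measurable_realfun complex ring lra zify.
Import Order.TTheory GRing.Theory Num.Theory.
Import numFieldNormedType.Exports.
Set Implicit Arguments.
Unset Strict Implicit.
Unset Printing Implicit Defensive.

(** Write [psi w = |sum_j a_j exp(i w.x_j)|^2].  Fourier inversion turns the
    quadratic form of [k(X,X)] into [kappa * energy], with the constant
    [kappa = (2 pi)^(- d / 2)], the energy being the integral of
    [Phihat * psi], and that of the symmetric part of [k(X+b,X)]
    into [kappa * (energy - deficit)], where the deficit is the integral of
    [Phihat * psi * (1 - cos (w.b))].  So everything reduces to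
    [0 < deficit <= energy / 4] and, for [tau > 1], to a sharper upper bound of
    the deficit.

    The only information about [psi] that is needed is how its mass is spread
    over the frequency space.  A product of triangle functions of width [r]
    (the tent) has an explicit Fourier transform, which is [r^d] at the origin
    and decays quadratically in every coordinate.  Expanding [psi], the integral
    of [tent r * psi] is [r^d |a|^2] plus off-diagonal terms; since the points
    are separated, Schur's test and a count of grid cells show that these are a
    small fraction of the main term as soon as [r] is a large multiple of [1/q]
    ([tent_trigpow_bounds]).  Here and below [h = 2 q / sqrt d]: distinct points
    differ by at least [h] in some coordinate.

    The lower half of this estimate, at [r ~ 1/q], bounds the energy below by a
    multiple of [q^(2 tau - d) |a|^2] ([weight_trigpow_lower]).  The upper half,
    summed over dyadic shells, bounds the part of the energy in frequencies
    above [N] by a multiple of [N^(d - 2 tau) |a|^2] ([weight_trigpow_tail]);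
    for [N] a large multiple of [1/q] that is a small fraction of the lower
    bound.  In frequencies below [N], [1 - cos (w.b)] is at most
    [|w|^2 |b|^2 / 2], which is small because [|b|] is small compared with [q].
    Together this gives [deficit <= energy / 4].  For the sharper bound the low
    frequencies are cut once more, at [|w|^2 = th], and [th] is optimized; this
    replaces an application of Hoelder's inequality ([deficit_le_young],
    [deficit_bounds]).

    Strict positivity comes from the same expansion: in the integral of
    [tent r * psi * (1 - cos (w.b))] the only frequency at the origin is the
    diagonal, because [b] is too short to be a difference of two points.  As
    [r] grows the diagonal wins, and [Phihat] dominates a positive multiple of
    any tent ([deficit_gt0]). *)

Local Open Scope classical_set_scope.
Local Open Scope ring_scope.

(** * The Fourier transform of the triangle function *)

Section tri.
Context {R : realType}.
Implicit Types r t z phi a b p q : R.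

Definition tri r t : R := Num.max 0 (1 - `|t| / r).

Definition tri_ft r z : R :=
  if z == 0 then r else 2 * (1 - cos (r * z)) / (r * z ^+ 2).

(** Integration over a segment on which the triangle function is affine; the
    primitive depends on whether [z] vanishes, so it is left to the caller. *)
Lemma integral_affine_cos (a b p q z phi : R) (F : R -> R) : a < b ->
  (forall t, is_derive t 1 F ((p + q * t) * cos (t * z + phi))) ->
  (\int[lebesgue_measure]_(t in `[a, b]) ((p + q * t) * cos (t * z + phi))%:E =
   (F b - F a)%:E)%E.
Proof.
move=> ab dF.
have cF t : {for t, continuous F}.
  apply/differentiable_continuous/derivable1_diffP.
  by have [] := dF t.
rewrite EFinB; apply: (@continuous_FTC2 R) => //.
- apply: continuous_subspaceT => t.
  have : is_derive t (1:R) (fun t : R => (p + q * t) * cos (t * z + phi))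
    (q * cos (t * z + phi) - (p + q * t) * (z * sin (t * z + phi))).
    apply: is_derive_eq; rewrite /GRing.scale /=; ring.
  by move=> [d _]; exact/differentiable_continuous/derivable1_diffP.
- split.
  + by move=> t _; have [] := dF t.
  + exact/cvg_at_right_filter/cF.
  + exact/cvg_at_left_filter/cF.
- by move=> t _; rewrite derive1E; have [_ ->] := dF t.
Qed.

Lemma tri_ge0 r t : 0 <= tri r t.
Proof. by rewrite /tri le_max lexx. Qed.

Lemma tri_le1 r t : 0 < r -> tri r t <= 1.
Proof. by move=> r0; rewrite /tri ge_max ler01 gerBl divr_ge0// ltW. Qed.

Lemma tri_eq0 r t : 0 < r -> r <= `|t| -> tri r t = 0.
Proof.
by move=> r0 rt; rewrite /tri max_l// subr_le0 ler_pdivlMr// mul1r.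
Qed.

Lemma tri_ge_half r t : 0 < r -> `|t| <= r / 2 -> 1 / 2 <= tri r t.
Proof.
move=> r0 rt; rewrite /tri le_max; apply/orP; right.
suff : `|t| / r <= 1 / 2 by lra.
by rewrite ler_pdivrMr// -mulrA mul1r mulrC.
Qed.

Lemma measurable_tri r : measurable_fun setT (tri r).
Proof.
apply: measurable_maxr; first exact: measurable_cst.
apply: measurable_funB; first exact: measurable_cst.
apply: measurable_funM; last exact: measurable_cst.
exact: normr_measurable.
Qed.

Lemma measurable_cosf d (T : measurableType d) (f : T -> R) :
  measurable_fun setT f -> measurable_fun setT (fun x => cos (f x)).
Proof.
move=> mf; apply: (measurableT_comp _ mf).
by apply: continuous_measurable_fun; exact: continuous_cos.
Qed.

Lemma measurable_tri_cos r z phi :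
  measurable_fun setT (fun t : R => tri r t * cos (t * z + phi)).
Proof.
apply: measurable_funM; first exact: measurable_tri.
apply: measurable_cosf; apply: measurable_funD; last exact: measurable_cst.
by apply: measurable_funM; [exact: measurable_id|exact: measurable_cst].
Qed.

Lemma integrable_tri_cos r z phi : 0 < r ->
  (@lebesgue_measure R).-integrable setT
    (fun t => (tri r t * cos (t * z + phi))%:E).
Proof.
move=> r0.
have := @integrable_indic_itv R (- r) r true false.
apply: le_integrable => //.
  by apply/measurable_EFinP; exact: measurable_tri_cos.
move=> t _; rewrite /= lee_fin normrM (ger0_norm (tri_ge0 _ _)).
apply: le_trans (_ : tri r t <= _).
  by rewrite ler_piMr ?tri_ge0// cos_max.
rewrite ger0_norm// indicE; case: (boolP (t \in _)) => [_|].
  exact: tri_le1.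
rewrite notin_setE /= in_itv /= => rt; rewrite tri_eq0// leNgt.
by apply/negP; rewrite ltr_norml => /andP[? ?]; apply: rt; rewrite !ltW.
Qed.

(** The phase [phi] is what makes the induction on the dimension go through: the
    remaining coordinates enter as a phase, and since [tri] is even only its
    cosine survives. *)
Lemma integral_tri_cos r z phi : 0 < r ->
  (\int[@lebesgue_measure R]_t (tri r t * cos (t * z + phi))%:E =
  (tri_ft r z * cos phi)%:E)%E.
Proof.
move=> r0.
pose g t : R := tri r t * cos (t * z + phi).
have mg := measurable_tri_cos r z phi.
(* The integrand vanishes off [-r, r]; split there at the kink of [tri]. *)
have -> : (\int[@lebesgue_measure R]_t (g t)%:E =
           \int[@lebesgue_measure R]_(t in `[(- r)%R, r]) (g t)%:E)%E.
  rewrite [RHS]integral_mkcond; apply: eq_integral => t _.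
  rewrite patchE; case: ifPn => //; rewrite notin_setE /= in_itv /=.
  move=> rt; rewrite /g tri_eq0 ?mul0r// leNgt; apply/negP; rewrite ltr_norml.
  by move=> /andP[? ?]; apply: rt; rewrite !ltW.
rewrite (@itv_bndbnd_setU _ _ _ (BRight (0:R))) ?bnd_simp ?oppr_le0 ?ltW//.
rewrite integral_setU//=; last 2 first.
- by apply/measurable_EFinP; exact: measurable_funTS.
- apply/disj_setPS => t [] /=; rewrite !in_itv /= => /andP[_ t0] /andP[].
  by rewrite ltNge t0.
rewrite (@integral_itv_obnd_cbnd _ 0); last first.
  by apply/measurable_EFinP; exact: measurable_funTS.
have rN : - r < 0 by rewrite oppr_lt0.
have neg t : t \in `[- r, 0] ->
    (g t)%:E = ((1 + r^-1 * t) * cos (t * z + phi))%:E.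
  rewrite in_itv /= => /andP[rt t0]; rewrite /g /tri ler0_norm// max_r.
    by congr (_ %:E); ring.
  by rewrite subr_ge0 ler_pdivrMr// mul1r lerNl.
have pos t : t \in `[0, r] ->
    (g t)%:E = ((1 + (- r^-1) * t) * cos (t * z + phi))%:E.
  rewrite in_itv /= => /andP[rt t0]; rewrite /g /tri ger0_norm// max_r.
    by congr (_ %:E); ring.
  by rewrite subr_ge0 ler_pdivrMr// mul1r.
have intN : (\int[@lebesgue_measure R]_(t in `[(- r)%R, 0%R]) (g t)%:E =
    \int[@lebesgue_measure R]_(t in `[(- r)%R, 0%R])
      ((1 + r^-1 * t) * cos (t * z + phi))%:E)%E.
  by apply: eq_integral => t; rewrite inE => /neg.
have intP : (\int[@lebesgue_measure R]_(t in `[0%R, r]) (g t)%:E =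
    \int[@lebesgue_measure R]_(t in `[0%R, r])
      ((1 + (- r^-1) * t) * cos (t * z + phi))%:E)%E.
  by apply: eq_integral => t; rewrite inE => /pos.
rewrite intN intP.
have rn0 : r != 0 by rewrite gt_eqF.
rewrite /tri_ft; case: (eqVneq z 0) => [->|zn0].
  have dF (q t : R) : is_derive t 1
      (fun t => (t + q / 2 * t ^+ 2) * cos phi)
      ((1 + q * t) * cos (t * 0 + phi)).
    by apply: is_derive_eq; rewrite /GRing.scale /= !mulr0 !add0r; field.
  rewrite (integral_affine_cos rN (dF _)) (integral_affine_cos r0 (dF _)).
  by rewrite -EFinD; congr (_ %:E); field.
have dF (q t : R) : is_derive t 1
    (fun t => (1 + q * t) * sin (t * z + phi) / z + q * cos (t * z + phi) / z ^+ 2)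
    ((1 + q * t) * cos (t * z + phi)).
  by apply: is_derive_eq; rewrite /GRing.scale /=; field.
rewrite (integral_affine_cos rN (dF _)) (integral_affine_cos r0 (dF _)).
rewrite -EFinD; congr (_ %:E).
rewrite !mul0r !add0r mulNr ![_ + phi]addrC.
rewrite !cosD !sinD cosN sinN; field.
by rewrite rn0 zn0.
Qed.

Lemma sin_sqr_le (x : R) : sin x ^+ 2 <= x ^+ 2.
Proof.
have key (y : R) : 0 < y -> sin y ^+ 2 <= y ^+ 2.
  move=> y0; have [|c _] := @MVT R sin cos (0 : R) y y0.
    by apply: continuous_subspaceT => ?; exact: continuous_sin.
  rewrite sin0 !subr0 => ->; rewrite exprMn ler_piMl ?sqr_ge0//.
case: (ltgtP x 0) => [x0|/key//|->]; last by rewrite sin0.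
by have := @key (- x); rewrite oppr_gt0 sinN !sqrrN => ->.
Qed.

Lemma one_sub_cos_le (x : R) : 1 - cos x <= x ^+ 2 / 2.
Proof.
have : cos x = 1 - 2 * sin (x / 2) ^+ 2.
  rewrite [in LHS](_ : x = (x / 2) *+ 2); last by rewrite mulr2n; field.
  by rewrite cos_mulr2n mulr2n; have := cos2Dsin2 (x / 2); lra.
have := sin_sqr_le (x / 2); rewrite expr_div_n; lra.
Qed.

Lemma tri_ft_ge0 r z : 0 < r -> 0 <= tri_ft r z.
Proof.
move=> r0; rewrite /tri_ft; case: ifPn => _; first exact: ltW.
apply: divr_ge0; last by rewrite mulr_ge0 ?sqr_ge0// ltW.
by rewrite mulr_ge0// subr_ge0 cos_le1.
Qed.

Lemma tri_ft_le r z : 0 < r -> tri_ft r z <= r.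
Proof.
move=> r0; rewrite /tri_ft; case: ifPn => // z0.
have z2 : 0 < z ^+ 2 by rewrite exprn_even_gt0.
rewrite ler_pdivrMr; last exact: mulr_gt0.
have := one_sub_cos_le (r * z); rewrite exprMn.
have -> : r * (r * z ^+ 2) = r ^+ 2 * z ^+ 2 by ring.
lra.
Qed.

Lemma tri_ft_decay r z : 0 < r -> z != 0 ->
  tri_ft r z <= r * (4 / (r * z) ^+ 2).
Proof.
move=> r0 z0; rewrite /tri_ft (negbTE z0).
have z2 : 0 < z ^+ 2 by rewrite exprn_even_gt0.
have -> : r * (4 / (r * z) ^+ 2) = 4 / (r * z ^+ 2).
  by field; rewrite z0 gt_eqF.
rewrite ler_pM2r; last by rewrite invr_gt0 mulr_gt0.
by have := cos_geN1 (r * z); lra.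
Qed.

End tri.

(** * Tents: products of triangle functions *)

Section tent.
Context {R : realType}.
Local Notation T := (measurableTypeR R).

Definition tdot d (w : d.-tuple T) (z : 'I_d -> R) : R :=
  \sum_(l < d) tnth w l * z l.

Definition tent (r : R) d (w : d.-tuple T) : R := \prod_(l < d) tri r (tnth w l).

Lemma measurable_tdot d (z : 'I_d -> R) :
  measurable_fun setT (fun w : d.-tuple T => tdot w z).
Proof.
apply: measurable_sum => l; apply: measurable_funM; last exact: measurable_cst.
exact: measurable_tnth.
Qed.

Lemma measurable_tent r d : measurable_fun setT (@tent r d).
Proof.
apply: measurable_prod => l _; apply: (measurableT_comp (measurable_tri r)).
exact: measurable_tnth.
Qed.

Lemma tent_ge0 r d (w : d.-tuple T) : 0 <= tent r w.
Proof. by apply: prodr_ge0 => l _; exact: tri_ge0. Qed.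

Lemma tent_le1 r d (w : d.-tuple T) : 0 < r -> tent r w <= 1.
Proof.
by move=> r0; apply: prodr_ile1 => l _; rewrite tri_ge0 tri_le1.
Qed.

Lemma tent_eq0 r d (w : d.-tuple T) l : 0 < r -> r <= `|tnth w l| ->
  tent r w = 0.
Proof. by move=> r0 rw; rewrite /tent (bigD1 l)//= tri_eq0// mul0r. Qed.

Lemma tent_ge_half r d (w : d.-tuple T) : 0 < r ->
  (forall l, `|tnth w l| <= r / 2) -> 2^-1 ^+ d <= tent r w.
Proof.
move=> r0 rw; rewrite -[d in X in X <= _]card_ord -prodr_const.
apply: ler_prod => l _; rewrite invr_ge0 ler0n/=.
by have := tri_ge_half r0 (rw l); rewrite mul1r.
Qed.

(** A tent is bounded by [1] and vanishes off a box of finite measure. *)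
Lemma integrable_tent r d : 0 < r ->
  (lebesgue_tuple R d).-integrable setT (EFin \o @tent r d).
Proof.
move=> r0.
pose B := [set w : d.-tuple T | forall l, `[(- r)%R, r]%classic (tnth w l)].
have mB : measurable B.
  rewrite (_ : B = \bigcap_(i in [set: 'I_d])
      ((fun t : d.-tuple T => tnth t i) @^-1` `[(- r)%R, r]%classic)).
    apply: fin_bigcap_measurable => // i _.
    by rewrite -[X in measurable X]setTI; exact: measurable_tnth.
  by apply/seteqP; split => t /= At i; [move=> _|]; exact: At.
have muB : (lebesgue_tuple R d B < +oo)%E.
  have := @lebesgue_tuple_box R d (fun=> `[(- r)%R, r]%classic).
  rewrite -/B => ->; last by move=> i; exact: measurable_itv.
  have rr : - r < r by lra.
  under eq_bigr do rewrite lebesgue_measure_itv/= lte_fin rr -EFinD.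
  suff /fineK <- : (\prod_(i < d) (r + - - r)%:E)%E \is a fin_num.
    exact: ltry.
  by elim/big_ind: _ => // x y; exact: fin_numM.
apply: (@le_integrable _ _ _ _ _ _ _ (EFin \o (\1_B : _ -> R))) => //.
- by apply/measurable_EFinP; exact: measurable_tent.
- move=> w _ /=; rewrite lee_fin !ger0_norm ?tent_ge0//.
  rewrite indicE; case: (boolP (w \in B)) => wB /=.
    exact: tent_le1.
  move: wB; rewrite notin_setE /B /= => /existsNP[l].
  rewrite in_itv /= => rwl; rewrite (@tent_eq0 _ _ _ l)//.
  rewrite leNgt; apply/negP; rewrite ltr_norml => /andP[? ?]; apply: rwl.
  by rewrite !ltW.
- apply/integrableP; split; first exact/measurable_EFinP/measurable_indic.
  rewrite (eq_integral (fun x => (\1_B x)%:E)); last first.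
    by move=> t _ /=; rewrite ger0_norm.
  by rewrite integral_indic// setIT.
Qed.

Lemma integrable_tent_cos r d (z : 'I_d -> R) phi : 0 < r ->
  (lebesgue_tuple R d).-integrable setT
    (fun w => (tent r w * cos (tdot w z + phi))%:E).
Proof.
move=> r0; apply: (le_integrable _ _ _ (integrable_tent d r0)) => //.
- apply/measurable_EFinP/measurable_funM; first exact: measurable_tent.
  apply: measurable_cosf; apply: measurable_funD; last exact: measurable_cst.
  exact: measurable_tdot.
- move=> w _; rewrite lee_fin normrM ler_piMr//; exact: cos_max.
Qed.

(** Fubini peels off the first coordinate [x]; the inner integral has the phase
    [x * z ord0 + phi], for which the induction hypothesis is stated. *)
Lemma integral_tent_cos r d (z : 'I_d -> R) phi : 0 < r ->
  (\int[lebesgue_tuple R d]_w (tent r w * cos (tdot w z + phi))%:E =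
   ((\prod_(l < d) tri_ft r (z l)) * cos phi)%:E)%E.
Proof.
move=> r0; elim: d z phi => [|d IH] z phi.
  rewrite /= integral_dirac//=; first by rewrite diracT mul1e /tent /tdot !big_ord0 add0r.
  by case/integrableP: (integrable_tent_cos z phi r0).
pose g (w : d.+1.-tuple T) := (tent r w * cos (tdot w z + phi))%:E.
have ig : (lebesgue_tuple R d.+1).-integrable setT g.
  exact: integrable_tent_cos.
have mg : measurable_fun setT g by case/integrableP: ig.
pose nu := (@lebesgue_measure R \x lebesgue_tuple R d)%E.
have mgt : measurable_fun setT (g \o @tcons R d).
  by apply: measurableT_comp => //; exact: measurable_tcons.
have igt : nu.-integrable setT (g \o @tcons R d).
  apply/integrableP; split => //.
  case/integrableP: ig => _.
  have := @ge0_integral_pushforward _ _ _ _ R (@tcons R d)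
    (@measurable_tcons R d) nu setT (abse \o g).
  move=> /(_ measurableT (measurableT_comp _ mg)) /=.
  by rewrite preimage_setT => -> .
have -> : (\int[lebesgue_tuple R d.+1]_w g w = \int[nu]_p g (tcons p))%E.
  have := @integral_pushforward _ _ _ _ R (@tcons R d)
    (@measurable_tcons R d) nu setT g mg.
  by rewrite preimage_setT => /(_ igt measurableT).
rewrite -(integral12_prod_meas1 igt) /fubini_F.
have gE x w : g (tcons (x, w)) =
   ((tri r x)%:E * (tent r w * cos (tdot w (fun l => z (lift ord0 l)) +
                                    (x * z ord0 + phi)))%:E)%E.
  rewrite /g /tent /tdot !big_ord_recl /= !tnth0 -EFinM -mulrA.
  under eq_bigr do rewrite tnthS.
  under [in X in cos X]eq_bigr do rewrite tnthS.
  by congr (_ * (_ * cos _))%:E; rewrite /=; ring.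
under eq_integral => x _.
  under eq_integral do rewrite [(_ \o _) _]gE.
  rewrite integralZl//; last exact: integrable_tent_cos.
  rewrite IH -EFinM.
  rewrite mulrCA EFinM.
  over.
rewrite integralZl//; last exact: integrable_tri_cos.
rewrite integral_tri_cos// big_ord_recl -EFinM; congr _%:E; ring.
Qed.

End tent.

(** * Separated points: counting and Schur's test *)

Section counting.
Context {R : realType}.

(** The function [min 1 (1 / t^2)], in a form that makes sense at [t = 0]. *)
Definition sqdecay (t : R) : R := (Num.max 1 (t ^+ 2))^-1.

Lemma sqdecay_max_gt0 (t : R) : 0 < Num.max 1 (t ^+ 2).
Proof. by rewrite lt_max ltr01. Qed.

Lemma sqdecay_ge0 (t : R) : 0 <= sqdecay t.
Proof. by rewrite invr_ge0 ltW// sqdecay_max_gt0. Qed.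

Lemma sqdecay_le (s t : R) : `|s| <= `|t| -> sqdecay t <= sqdecay s.
Proof.
move=> st; rewrite lef_pV2 ?posrE ?sqdecay_max_gt0//.
rewrite ge_max le_max lexx /= le_max; apply/orP; right.
by rewrite -(real_normK (num_real s)) -(real_normK (num_real t)) lerXn2r ?nnegrE.
Qed.

(** Telescoping with [1 / (k + 1)^2 <= 2 / (k + 1) - 2 / (k + 2)]. *)
Lemma sum_sqdecay_pred (n : nat) : \sum_(k < n) sqdecay k.-1%:R <= 4.
Proof.
have key m : \sum_(k < m.+2) sqdecay k.-1%:R <= 4 - 2 / m.+1%:R.
  elim: m => [|m IH].
    rewrite !big_ord_recr big_ord0 /= /sqdecay expr0n max_l// invr1; lra.
  rewrite big_ord_recr /=; apply: le_trans (lerD IH (lexx _)) _.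
  rewrite /sqdecay max_r; last by rewrite exprn_ege1// ler1n.
  rewrite -[m.+2%:R]natr1; set a : R := m.+1%:R.
  have a1 : 1 <= a by rewrite ler1n.
  rewrite -subr_ge0.
  have -> : 4 - 2 / (a + 1) - (4 - 2 / a + (a ^+ 2)^-1) =
      (a - 1) / (a ^+ 2 * (a + 1)).
    by field; rewrite !gt_eqF//; lra.
  by rewrite divr_ge0// ?mulr_ge0//; try lra; rewrite ?sqr_ge0.
case: n => [|[|n]]; rewrite ?big_ord0// ?big_ord1.
  by rewrite /= /sqdecay expr0n max_l// invr1; lra.
by apply: le_trans (key n) _; rewrite gerBl divr_ge0.
Qed.

(** Two reals whose floors differ by [k] are more than [k - 1] apart; with the
    truncated predecessor the case [k = 0] is included. *)
Lemma floor_gap (a b : R) (k : nat) : `|Num.floor a - Num.floor b|%N = k ->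
  k.-1%:R <= `|a - b|.
Proof.
move=> fk; have [/andP[a1 a2] /andP[b1 b2]] := (floor_itv a, floor_itv b).
have : (k%:R : R) = `|(Num.floor a)%:~R - (Num.floor b)%:~R|.
  by rewrite -fk -intrB -intr_norm natr_absz.
rewrite !intrD in a2 b2.
case: k {fk} => [|k] //=; rewrite -natr1.
have k0 : 0 <= k%:R :> R by [].
set u := (Num.floor a)%:~R in a1 a2 *; set v := (Num.floor b)%:~R in b1 b2 *.
move=> E; have [uv|uv] := leP u v.
  move: E; rewrite ler0_norm; last by lra.
  by move=> E; rewrite ler0_norm; lra.
move: E; rewrite gtr0_norm; last by lra.
by move=> E; rewrite ger0_norm; lra.
Qed.

Lemma floor_eq_near (a b : R) : Num.floor a = Num.floor b -> `|a - b| < 1.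
Proof.
move=> fk; have [/andP[a1 a2] /andP[b1 b2]] := (floor_itv a, floor_itv b).
by move: a1 a2; rewrite fk => a1 a2; rewrite ltr_norml; rewrite intrD in a2 b2; lra.
Qed.

Lemma sum_inj_le (I J : finType) (phi : I -> J) (G : J -> R) :
  injective phi -> (forall j, 0 <= G j) -> \sum_i G (phi i) <= \sum_j G j.
Proof.
move=> phiI G0; rewrite [leRHS](bigID (mem (phi @: [set: I])%SET)) /=.
rewrite [X in _ <= X + _]big_imset /=; last by move=> ? ? _ _; exact: phiI.
by under [X in _ <= X + _]eq_bigl do rewrite inE; rewrite lerDl sumr_ge0.
Qed.

(** Cut space into cells of side [h].  Separation puts at most one point in each
    cell, so the sum over the points is at most the sum over all cells, where
    the summand is replaced by its bound in terms of the offset from the cell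
    of [x i].  That sum factors over the coordinates, and each factor is at
    most [2 * 4], the [2] accounting for the sign of the offset. *)
Lemma sum_sqdecay_separated (n d : nat) (h : R) (x : 'I_n -> 'I_d -> R) (i : 'I_n) :
  0 < h -> (forall i j, i != j -> exists l, h <= `|x i l - x j l|) ->
  \sum_j \prod_(l < d) sqdecay ((x i l - x j l) / h) <= 8 ^+ d.
Proof.
move=> h0 sep.
pose m j l := Num.floor (x j l / h).
pose Q := (\max_(j < n) \max_(l < d) `|m i l - m j l|)%N.
have mQ j l : (`|m i l - m j l| < Q.+1)%N.
  rewrite ltnS; apply: leq_trans (leq_bigmax j).
  exact: (leq_bigmax (F := fun l => `|m i l - m j l|%N) l).
pose code j : {ffun 'I_d -> 'I_Q.+1 * bool} :=
  [ffun l => (Ordinal (mQ j l), m i l <= m j l)].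
have codeI : injective code.
  move=> j j' /ffunP E; apply/eqP; apply: contraT => jj'.
  have [l] := sep _ _ jj'; rewrite leNgt => /negP[].
  have : m j l = m j' l.
    have := E l; rewrite !ffunE => -[].
    lia.
  move=> /floor_eq_near; rewrite -mulrBl normrM (gtr0_norm (_ : 0 < h^-1)) ?invr_gt0//.
  by rewrite ltr_pdivrMr// mul1r.
pose G (f : {ffun 'I_d -> 'I_Q.+1 * bool}) : R :=
  \prod_l sqdecay (f l).1.-1%:R.
apply: (@le_trans _ _ (\sum_j G (code j))).
  apply: ler_sum => j _; apply: ler_prod => l _; rewrite sqdecay_ge0 /=.
  apply: sqdecay_le; rewrite ffunE /= ger0_norm// mulrBl.
  exact: floor_gap.
apply: le_trans (sum_inj_le codeI _) _.
  by move=> f; apply: prodr_ge0 => l _; exact: sqdecay_ge0.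
rewrite -(bigA_distr_bigA (fun=> fun p : 'I_Q.+1 * bool => sqdecay p.1.-1%:R)).
rewrite prodr_const card_ord lerXn2r ?nnegrE//.
  by apply: sumr_ge0 => p _; exact: sqdecay_ge0.
rewrite -(pair_bigA _ (fun (a : 'I_Q.+1) (b : bool) => sqdecay a.-1%:R)) /=.
under eq_bigr do rewrite big_bool/=.
by rewrite big_split /=; have := sum_sqdecay_pred Q.+1; lra.
Qed.

Lemma schur_test (n : nat) (G : 'I_n -> 'I_n -> R) (B : R) (a : 'I_n -> R) :
  (forall i j, 0 <= G i j) -> (forall i j, G i j = G j i) ->
  (forall i, \sum_(j | j != i) G i j <= B) ->
  `|\sum_i \sum_(j | j != i) a i * a j * G i j| <= B * \sum_i a i ^+ 2.
Proof.
move=> G0 Gs GB.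
apply: le_trans (ler_norm_sum _ _ _) _.
apply: (@le_trans _ _ (\sum_i \sum_(j | j != i)
    (a i ^+ 2 / 2 * G i j + a j ^+ 2 / 2 * G i j))).
  apply: ler_sum => i _; apply: le_trans (ler_norm_sum _ _ _) _.
  apply: ler_sum => j _; rewrite normrM (ger0_norm (G0 i j)) -mulrDl.
  apply: ler_wpM2r => //; rewrite normrM.
  rewrite -(real_normK (num_real (a i))) -(real_normK (num_real (a j))).
  have := sqr_ge0 (`|a i| - `|a j|); rewrite sqrrB; lra.
have half : \sum_i \sum_(j | j != i) a i ^+ 2 / 2 * G i j <= B / 2 * \sum_i a i ^+ 2.
  rewrite mulr_sumr; apply: ler_sum => i _; rewrite -mulr_sumr.
  rewrite mulrC [leRHS]mulrC [leRHS]mulrA [leRHS]mulrAC [leRHS]mulrC.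
  rewrite ler_wpM2r ?divr_ge0 ?sqr_ge0//.
under eq_bigr do rewrite big_split /=.
rewrite big_split /= [B in leRHS]splitr mulrDl lerD//.
apply: le_trans half; rewrite (exchange_big_dep predT)//=.
apply: ler_sum => i _; rewrite le_eqVlt; apply/orP; left; apply/eqP.
by apply: eq_big => j; rewrite 1?eq_sym// => _; rewrite Gs.
Qed.

End counting.

(** * Mean values of trigonometric sums with separated frequencies *)

Section Rintegral_sum.
Context d (T : measurableType d) (R : realType).
Context (mu : {measure set T -> \bar R}).

Lemma integrable_Rsum (I : finType) (F : I -> T -> R) :
  (forall i, mu.-integrable setT (EFin \o F i)) ->
  mu.-integrable setT (EFin \o (fun w => \sum_i F i w)).
Proof.
move=> iF; have := @integrable_sum _ _ _ mu setT measurableT _ (index_enum I)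
  predT (fun i => EFin \o F i) (fun i _ => iF i).
by apply: eq_integrable => // w _ /=; rewrite sumEFin.
Qed.

Lemma Rintegral_sum (I : finType) (F : I -> T -> R) :
  (forall i, mu.-integrable setT (EFin \o F i)) ->
  \int[mu]_w (\sum_i F i w) = \sum_i \int[mu]_w F i w.
Proof.
move=> iF; rewrite /Rintegral.
under eq_integral do rewrite -sumEFin.
rewrite (@integral_sum _ _ _ mu setT measurableT _ (fun i => EFin \o F i) iF).
rewrite sum_fine//.
by move=> i _; apply: integrable_fin_num => //; exact: iF.
Qed.

End Rintegral_sum.

Section sieve.
Context {R : realType}.
Local Notation T := (measurableTypeR R).

Lemma integrable_tent_cos0 r d (z : 'I_d -> R) : 0 < r ->
  (lebesgue_tuple R d).-integrable setT
    (EFin \o (fun w : d.-tuple T => tent r w * cos (tdot w z))).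
Proof.
move=> r0; have := integrable_tent_cos z 0 r0.
by apply: eq_integrable => // w _ /=; rewrite addr0.
Qed.

Lemma Rintegral_tent_cos r d (z : 'I_d -> R) : 0 < r ->
  \int[lebesgue_tuple R d]_w (tent r w * cos (tdot w z)) =
  \prod_(l < d) tri_ft r (z l).
Proof.
move=> r0; rewrite /Rintegral.
under eq_integral do rewrite -[tdot _ _]addr0.
by rewrite integral_tent_cos//= cos0 mulr1.
Qed.

Lemma integrable_tent_trigsum (P : finType) r d (c : P -> R)
    (z : P -> 'I_d -> R) : 0 < r ->
  (lebesgue_tuple R d).-integrable setT
    (EFin \o (fun w : d.-tuple T => tent r w * \sum_p c p * cos (tdot w (z p)))).
Proof.
move=> r0.
under [X in _.-integrable _ (_ \o X)]eq_fun do rewrite mulr_sumr.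
apply: integrable_Rsum => p.
have := integrableZl measurableT (c p) (integrable_tent_cos0 (z p) r0).
by apply: eq_integrable => // w _ /=; rewrite -EFinM; congr (_%:E); ring.
Qed.

Lemma Rintegral_tent_trigsum (P : finType) r d (c : P -> R)
    (z : P -> 'I_d -> R) : 0 < r ->
  \int[lebesgue_tuple R d]_w (tent r w * \sum_p c p * cos (tdot w (z p))) =
  \sum_p c p * \prod_(l < d) tri_ft r (z p l).
Proof.
move=> r0; under eq_Rintegral do rewrite mulr_sumr.
have E p (w : d.-tuple T) : tent r w * (c p * cos (tdot w (z p))) =
    c p * (tent r w * cos (tdot w (z p))) by ring.
rewrite (Rintegral_sum (F := fun p w => tent r w * (c p * cos (tdot w (z p))))).
  apply: eq_bigr => p _; under eq_Rintegral do rewrite E.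
  by rewrite RintegralZl ?Rintegral_tent_cos//; exact: integrable_tent_cos0.
move=> p.
have := integrableZl measurableT (c p) (integrable_tent_cos0 (z p) r0).
by apply: eq_integrable => // w _ /=; rewrite -EFinM; congr (_%:E); ring.
Qed.

(** Below the scale [h] the trivial bound [r] suffices, and above it the
    quadratic decay is at least as good as [h^2 / z^2] because [2 <= r * h]. *)
Lemma tri_ft_sqdecay (r h z : R) : 0 < h -> 2 <= r * h ->
  tri_ft r z <= r * sqdecay (z / h).
Proof.
move=> h0 rh; have r0 : 0 < r by rewrite -(pmulr_lgt0 _ h0); lra.
rewrite /sqdecay; case: (leP 1 ((z / h) ^+ 2)) => zh; last first.
  by rewrite invr1 mulr1 tri_ft_le.
have z0 : z != 0 by apply: contraTneq zh => ->; rewrite mul0r expr0n -ltNge ltr01.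
apply: le_trans (tri_ft_decay r0 z0) _; rewrite ler_pM2l// .
have zz : 0 < z ^+ 2 by rewrite exprn_even_gt0.
have -> : ((z / h) ^+ 2)^-1 = h ^+ 2 / z ^+ 2 by field; rewrite z0 gt_eqF.
rewrite exprMn invfM mulrA ler_pM2r ?invr_gt0// ler_pdivrMr ?exprn_gt0//.
by rewrite -exprMn mulrC -[4]/(2 * 2)%:R natrM -expr2 lerXn2r ?nnegrE ?mulr_ge0//; lra.
Qed.

Lemma tri_ft_far (r h z : R) : 0 < h -> 2 <= r * h -> h <= `|z| ->
  tri_ft r z <= 4 / (r * h) ^+ 2 * (r * sqdecay (z / h)).
Proof.
move=> h0 rh hz; have r0 : 0 < r by rewrite -(pmulr_lgt0 _ h0); lra.
have z0 : z != 0 by rewrite -normr_gt0; exact: lt_le_trans hz.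
have zh : 1 <= (z / h) ^+ 2.
  rewrite -real_normK ?num_real// exprn_ege1//.
  by rewrite normrM normfV (gtr0_norm h0) ler_pdivlMr// mul1r.
rewrite /sqdecay max_r//.
apply: le_trans (tri_ft_decay r0 z0) _; rewrite le_eqVlt; apply/orP; left.
by apply/eqP; field; rewrite z0 !gt_eqF.
Qed.

(** The far coordinate contributes the gain [4 / (r h)^2]; all of them decay. *)
Lemma prod_tri_ft_le d (r h : R) (z : 'I_d -> R) : 0 < h -> 2 <= r * h ->
  (exists l, h <= `|z l|) ->
  \prod_(l < d) tri_ft r (z l) <=
  4 / (r * h) ^+ 2 * (r ^+ d * \prod_(l < d) sqdecay (z l / h)).
Proof.
move=> h0 rh [l0 hl]; have r0 : 0 < r by rewrite -(pmulr_lgt0 _ h0); lra.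
rewrite -[in r ^+ d](card_ord d) -prodr_const -big_split/=.
rewrite (bigD1 l0)//= [in leRHS](bigD1 l0)//= mulrA.
apply: ler_pM => //; [exact: tri_ft_ge0| |exact: tri_ft_far|].
  by apply: prodr_ge0 => *; exact: tri_ft_ge0.
apply: ler_prod => l _; rewrite tri_ft_ge0//=; exact: tri_ft_sqdecay.
Qed.

Lemma tri_ft0 r : tri_ft r 0 = r :> R.
Proof. by rewrite /tri_ft eqxx. Qed.

Lemma tri_ftN r (z : R) : tri_ft r (- z) = tri_ft r z.
Proof. by rewrite /tri_ft oppr_eq0 sqrrN mulrN cosN. Qed.

(** Separation in the maximum norm, which is the one that fits the product
    structure of the tents. *)
Definition coord_separated n d (h : R) (x : 'I_n -> 'I_d -> R) :=
  forall i j, i != j -> exists l, h <= `|x i l - x j l|.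

(** The squared modulus of [sum_j a_j exp(i w.x_j)], expanded so that it is
    visibly a combination of cosines (see [trigpow_sqr]). *)
Definition trigpow n d (x : 'I_n -> 'I_d -> R) (a : 'I_n -> R) (w : d.-tuple T) : R :=
  \sum_(p : 'I_n * 'I_n) a p.1 * a p.2 * cos (tdot w (fun l => x p.1 l - x p.2 l)).

(** The diagonal of the expansion of [trigpow] gives [r^d |a|^2]; Schur's test
    bounds the rest. *)
Lemma tent_trigpow_near n d (h r : R) (x : 'I_n -> 'I_d -> R) (a : 'I_n -> R) :
  0 < h -> 2 <= r * h -> coord_separated h x ->
  `| \int[lebesgue_tuple R d]_w (tent r w * trigpow x a w)
     - r ^+ d * \sum_i a i ^+ 2 |
  <= 4 / (r * h) ^+ 2 * 8 ^+ d * (r ^+ d * \sum_i a i ^+ 2).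
Proof.
move=> h0 rh sep; have r0 : 0 < r by rewrite -(pmulr_lgt0 _ h0); lra.
rewrite (Rintegral_tent_trigsum (fun p => a p.1 * a p.2)
  (fun p : 'I_n * 'I_n => fun l => x p.1 l - x p.2 l) r0).
rewrite -(pair_bigA _ (fun i j => a i * a j * \prod_(l < d) tri_ft r (x i l - x j l))) /=.
pose G i j := \prod_(l < d) tri_ft r (x i l - x j l).
have -> : \sum_i \sum_j a i * a j * G i j =
    r ^+ d * (\sum_i a i ^+ 2) + \sum_i \sum_(j | j != i) a i * a j * G i j.
  rewrite mulr_sumr -big_split /=; apply: eq_bigr => i _.
  rewrite (bigD1 i)//=; congr (_ + _).
  rewrite /G; under eq_bigr do rewrite subrr tri_ft0.
  by rewrite prodr_const card_ord mulrC expr2.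
rewrite addrAC subrr add0r [_ * (r ^+ d * _)]mulrA.
apply: schur_test => [i j|i j|i].
- by apply: prodr_ge0 => l _; exact: tri_ft_ge0.
- by apply: eq_bigr => l _; rewrite -tri_ftN opprB.
- have -> : 4 / (r * h) ^+ 2 * 8 ^+ d * r ^+ d = 4 / (r * h) ^+ 2 * r ^+ d * 8 ^+ d by ring.
  apply: (@le_trans _ _ (4 / (r * h) ^+ 2 * r ^+ d *
      \sum_(j | j != i) \prod_(l < d) sqdecay ((x i l - x j l) / h))).
    rewrite mulr_sumr; apply: ler_sum => j ij; rewrite -mulrA.
    by apply: prod_tri_ft_le => //; apply: sep; rewrite eq_sym.
  apply: ler_wpM2l.
    by rewrite !mulr_ge0 ?exprn_ge0 ?invr_ge0 ?exprn_ge0//; lra.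
  apply: le_trans (sum_sqdecay_separated i h0 sep).
  rewrite [leRHS](bigID (fun j => j != i))/= lerDl sumr_ge0// => j _.
  by apply: prodr_ge0 => l _; exact: sqdecay_ge0.
Qed.

(** From [r >= 8^(d+1) / h] on, the relative error in [tent_trigpow_near] is at
    most one half. *)
Lemma tent_trigpow_bounds n d (h r : R) (x : 'I_n -> 'I_d -> R) (a : 'I_n -> R) :
  0 < h -> coord_separated h x -> 8 ^+ d.+1 / h <= r ->
  r ^+ d * (\sum_i a i ^+ 2) / 2 <=
    \int[lebesgue_tuple R d]_w (tent r w * trigpow x a w) <=
  2 * (r ^+ d * \sum_i a i ^+ 2).
Proof.
move=> h0 sep rL.
have L1 : 1 <= 8 ^+ d :> R by rewrite exprn_ege1//; lra.
have rh : 8 * 8 ^+ d <= r * h by rewrite -exprS -ler_pdivrMr.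
have r0 : 0 < r by rewrite -(pmulr_lgt0 _ h0); lra.
have := tent_trigpow_near a h0 _ sep => /(_ r).
set A := r ^+ d * _; have A0 : 0 <= A.
  apply: mulr_ge0; first exact/exprn_ge0/ltW.
  by apply: sumr_ge0 => i _; exact: sqr_ge0.
move=> /(_ ltac:(lra)) H.
suff e : 4 / (r * h) ^+ 2 * 8 ^+ d <= 1 / 2.
  have := le_trans H (ler_wpM2r A0 e); rewrite ler_norml; lra.
rewrite mulrAC ler_pdivrMr ?exprn_gt0//; last lra.
have : (8 * 8 ^+ d) * (8 * 8 ^+ d) <= (r * h) ^+ 2.
  by rewrite expr2 ler_pM//; lra.
have : 8 ^+ d * 1 <= 8 ^+ d * 8 ^+ d :> R by rewrite ler_wpM2l//; lra.
lra.
Qed.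

Lemma trigpow_sqr n d (x : 'I_n -> 'I_d -> R) (a : 'I_n -> R) w :
  trigpow x a w = (\sum_i a i * cos (tdot w (x i))) ^+ 2 +
                  (\sum_i a i * sin (tdot w (x i))) ^+ 2.
Proof.
rewrite /trigpow -(pair_bigA _ (fun i j =>
  a i * a j * cos (tdot w (fun l => x i l - x j l)))) /=.
rewrite !expr2 !big_distrlr /= -big_split /=; apply: eq_bigr => i _.
rewrite -big_split /=; apply: eq_bigr => j _.
have -> : tdot w (fun l => x i l - x j l) = tdot w (x i) - tdot w (x j).
  by rewrite /tdot -sumrB; apply: eq_bigr => l _; rewrite mulrBr.
rewrite cosB; ring.
Qed.

Lemma trigpow_ge0 n d (x : 'I_n -> 'I_d -> R) (a : 'I_n -> R) w :
  0 <= trigpow x a w.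
Proof. by rewrite trigpow_sqr addr_ge0// sqr_ge0. Qed.

Lemma measurable_trigpow n d (x : 'I_n -> 'I_d -> R) (a : 'I_n -> R) :
  measurable_fun setT (trigpow x a).
Proof.
apply: measurable_sum => p; apply: measurable_funM; first exact: measurable_cst.
by apply: measurable_cosf; exact: measurable_tdot.
Qed.

Lemma trigpow_le n d (x : 'I_n -> 'I_d -> R) (a : 'I_n -> R) w :
  trigpow x a w <= \sum_(p : 'I_n * 'I_n) `|a p.1 * a p.2|.
Proof.
apply: ler_sum => p _; apply: le_trans (ler_norm _) _.
by rewrite normrM ler_piMr// cos_max.
Qed.

End sieve.

(** * Mean values after a shift *)

Section strict.
Context {R : realType}.
Local Notation T := (measurableTypeR R).

Lemma prod_tri_ft_far d (r h : R) (z : 'I_d -> R) : 0 < h -> 2 <= r * h ->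
  (exists l, h <= `|z l|) ->
  `|\prod_(l < d) tri_ft r (z l)| <= 4 / (r * h) ^+ 2 * r ^+ d.
Proof.
move=> h0 rh hl; have r0 : 0 < r by rewrite -(pmulr_lgt0 _ h0); lra.
rewrite ger0_norm; last by apply: prodr_ge0 => l _; exact: tri_ft_ge0.
apply: le_trans (prod_tri_ft_le h0 rh hl) _; rewrite mulrA ler_piMr//.
  by rewrite mulr_ge0 ?exprn_ge0 ?divr_ge0 ?exprn_ge0//; lra.
apply: prodr_ile1 => l _; rewrite sqdecay_ge0 /= invf_le1 ?sqdecay_max_gt0//.
by rewrite le_max lexx.
Qed.

Lemma gt0_perturb (k u v e : R) :
  `|u| <= e -> `|v| <= e -> 2 * e < k -> 0 < k + u + v.
Proof. by rewrite !ler_norml => /andP[? _] /andP[? _] ?; lra. Qed.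

(** The product formula turns [trigpow x a w * (1 - cos (w.b))] into cosines with
    frequencies [x i - x j] and [x i - x j +- b].  The diagonal ones among the
    first contribute [r^d |a|^2]; all others are bounded away from the origin,
    so that they contribute [O(r^(d-2))], which loses for large [r]. *)
Lemma tent_trigpow_shift_gt0 n d (h : R) (x : 'I_n -> 'I_d -> R) (b : 'I_d -> R)
    (a : 'I_n -> R) :
  0 < h -> coord_separated h x ->
  (forall i j (s : bool), exists l, h <= `|x i l - x j l + (-1) ^+ s * b l|) ->
  0 < \sum_i a i ^+ 2 ->
  exists2 r, 0 < r &
    0 < \int[lebesgue_tuple R d]_w
      (tent r w * (trigpow x a w * (1 - cos (tdot w b)))).
Proof.
move=> h0 sep sepb A0; set A := \sum_i _ in A0.
pose P := ('I_n * 'I_n)%type.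
pose c (p : P) := a p.1 * a p.2.
pose z (p : P) l := x p.1 l - x p.2 l.
pose c' (p : P + P * bool) := match p with inl p => c p | inr p => - c p.1 / 2 end.
pose z' (p : P + P * bool) l :=
  match p with inl p => z p l | inr p => z p.1 l + (-1) ^+ p.2 * b l end.
pose S := \sum_p `|c p|.
have S0 : 0 <= S by apply: sumr_ge0.
(* [u = r * h] is chosen such that [8 S / u^2 < A] and [2 <= u]. *)
pose u := 2 + 8 * S / A.
have u2 : 2 <= u by rewrite lerDl; apply: divr_ge0; [exact: mulr_ge0|exact: ltW].
pose r := u / h.
have rh : r * h = u by rewrite /r divfK// gt_eqF.
have r0 : 0 < r by rewrite divr_gt0//; lra.
exists r => //.
have E (w : d.-tuple T) : trigpow x a w * (1 - cos (tdot w b)) =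
      \sum_p c' p * cos (tdot w (z' p)).
    rewrite big_sumType /= -(pair_bigA _ (fun p (s : bool) => - c p / 2 *
       cos (tdot w (fun l => z p l + (-1) ^+ s * b l)))) /=.
    rewrite -big_split /= /trigpow mulr_suml; apply: eq_bigr => p _.
    rewrite big_bool /=.
    have td (e : R) : tdot w (fun l => z p l + e * b l) = tdot w (z p) + e * tdot w b.
      rewrite /tdot mulr_sumr -big_split/=; apply: eq_bigr => l _; ring.
    rewrite expr1 expr0 !td mulN1r mul1r cosB cosD /c /z; by field.
under eq_Rintegral do rewrite E.
rewrite Rintegral_tent_trigsum// big_sumType /=.
rewrite -(pair_bigA _ (fun p (s : bool) => - c p / 2 *
   \prod_(l < d) tri_ft r (z p l + (-1) ^+ s * b l))) /=.
rewrite -(pair_bigA _ (fun i j => a i * a j * \prod_(l < d) tri_ft r (x i l - x j l))) /=.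
have -> : \sum_i \sum_j a i * a j * \prod_(l < d) tri_ft r (x i l - x j l) =
    r ^+ d * A + \sum_i \sum_(j | j != i) a i * a j *
                       \prod_(l < d) tri_ft r (x i l - x j l).
  rewrite mulr_sumr -big_split /=; apply: eq_bigr => i _.
  rewrite (bigD1 i)//=; congr (_ + _).
  under eq_bigr do rewrite subrr tri_ft0.
  by rewrite prodr_const card_ord mulrC expr2.
pose e := 4 / u ^+ 2 * r ^+ d.
have e0 : 0 <= e by rewrite mulr_ge0 ?divr_ge0 ?exprn_ge0//; lra.
have B1 : `|\sum_i \sum_(j | j != i) a i * a j *
                       \prod_(l < d) tri_ft r (x i l - x j l)| <= S * e.
  rewrite /S -(pair_bigA _ (fun i j => `|a i * a j|)) mulr_suml.
  apply: le_trans (ler_norm_sum _ _ _) _; apply: ler_sum => i _.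
  apply: le_trans (ler_norm_sum _ _ _) _.
  rewrite mulr_suml [leRHS](bigID (fun j => j != i)) /=.
  apply: ler_wpDr; first by apply: sumr_ge0 => j _; rewrite mulr_ge0.
  apply: ler_sum => j ij; rewrite normrM ler_wpM2l// /e -rh.
  by apply: prod_tri_ft_far; rewrite ?rh//; apply: sep; rewrite eq_sym.
have B2 : `|\sum_p \sum_(s : bool) - c p / 2 *
   \prod_(l < d) tri_ft r (z p l + (-1) ^+ s * b l)| <= S * e.
  apply: le_trans (ler_norm_sum _ _ _) _; rewrite mulr_suml.
  apply: ler_sum => p _; apply: le_trans (ler_norm_sum _ _ _) _.
  have F (s : bool) : `|\prod_(l < d) tri_ft r (z p l + (-1) ^+ s * b l)| <= e.
    by rewrite /e -rh; apply: prod_tri_ft_far; rewrite ?rh//; exact: sepb.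
  have -> : `|c p| * e = `|- c p / 2| * e + `|- c p / 2| * e.
    rewrite [`|- c p / 2|]normrM normrN (gtr0_norm (_ : 0 < 2^-1 :> R)) ?invr_gt0//.
    by rewrite -mulrDl -splitr.
  rewrite big_bool /=; apply: lerD; rewrite normrM; apply: ler_wpM2l => //.
    exact: (F true).
  exact: (F false).
apply: (gt0_perturb B1 B2).
rewrite /e; have -> : 2 * (S * (4 / u ^+ 2 * r ^+ d)) = r ^+ d * (8 * S / u ^+ 2) by ring.
have u0 : 0 < u by lra.
rewrite ltr_pM2l ?exprn_gt0// ltr_pdivrMr ?exprn_gt0//.
have -> : 8 * S = (u - 2) * A by rewrite /u; field; rewrite gt_eqF.
rewrite mulrC ltr_pM2l//.
have : 2 * u <= u ^+ 2 by rewrite expr2 ler_wpM2r//; lra.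
lra.
Qed.

End strict.

(** * Energy against a weight of algebraic decay *)

Lemma powR_expR (R : realType) (x r : R) : 0 < x -> x `^ r = expR (r * ln x).
Proof. by move=> x0; rewrite /powR gt_eqF. Qed.

Lemma powRN_le (R : realType) (x y r : R) : 0 < x -> x <= y -> 0 <= r ->
  y `^ (- r) <= x `^ (- r).
Proof.
move=> x0 xy r0; have y0 := lt_le_trans x0 xy.
rewrite !powRN lef_pV2 ?posrE ?powR_gt0//.
by apply: ge0_ler_powR => //; rewrite nnegrE ltW.
Qed.

Lemma geometric_sum_le (R : realType) (q : R) n : 0 <= q -> q < 1 ->
  \sum_(k < n) q ^+ k <= (1 - q)^-1.
Proof.
move=> q0 q1; rewrite -[leRHS]mul1r ler_pdivlMr ?subr_gt0//.
have := subrX1 q n; have : 0 <= q ^+ n by rewrite exprn_ge0.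
lra.
Qed.

Section weight.
Context {R : realType}.
Local Notation T := (measurableTypeR R).

Definition nsq d (w : d.-tuple T) : R := \sum_(l < d) tnth w l ^+ 2.

Lemma nsq_ge0 d (w : d.-tuple T) : 0 <= nsq w.
Proof. by apply: sumr_ge0 => l _; exact: sqr_ge0. Qed.

Lemma nsq_ge d (w : d.-tuple T) l N : 0 <= N -> N <= `|tnth w l| -> N ^+ 2 <= nsq w.
Proof.
move=> N0 Nw; rewrite /nsq (bigD1 l)//=; apply: ler_wpDr.
  by apply: sumr_ge0 => k _; exact: sqr_ge0.
by rewrite -[leRHS]real_normK ?num_real// lerXn2r ?nnegrE.
Qed.

Lemma nsq_le d (w : d.-tuple T) N : (forall l, `|tnth w l| <= N) ->
  nsq w <= d%:R * N ^+ 2.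
Proof.
move=> wN; apply: (@le_trans _ _ (\sum_(l < d) N ^+ 2)).
  apply: ler_sum => l _.
  by rewrite -[leLHS]real_normK ?num_real// lerXn2r ?nnegrE// (le_trans _ (wN l)).
by rewrite sumr_const card_ord mulr_natl.
Qed.

Context (d : nat) (tau cP CP : R) (g : d.-tuple T -> R).
Context (tau_gt : d%:R / 2 < tau) (cP0 : 0 < cP) (CP0 : 0 < CP).
Context (g_int : (lebesgue_tuple R d).-integrable setT (EFin \o g)).
Context (g_lb : forall w, cP * (1 + nsq w) `^ (- tau) <= g w).
Context (g_ub : forall w, g w <= CP * (1 + nsq w) `^ (- tau)).

Let tau0 : 0 < tau.
Proof. by apply: le_lt_trans tau_gt; rewrite divr_ge0. Qed.

Lemma weight_ge0 w : 0 <= g w.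
Proof. by apply: le_trans (g_lb w); rewrite mulr_ge0 ?powR_ge0 ?ltW. Qed.

Lemma integrable_weightM (m : d.-tuple T -> R) (M : R) :
  measurable_fun setT m -> (forall w, `|m w| <= M) ->
  (lebesgue_tuple R d).-integrable setT (EFin \o (fun w => g w * m w)).
Proof.
move=> mm mM; have := integrableMl measurableT g_int mm.
have bm : [bounded m x | x in [set: d.-tuple T]].
  exists M; split; first exact: num_real.
  by move=> y My w _ /=; apply: le_trans (mM w) (ltW My).
by move=> /(_ bm); apply: eq_integrable.
Qed.

Lemma trigpow_norm n (x : 'I_n -> 'I_d -> R) a (w : d.-tuple T) :
  `|trigpow x a w| <= \sum_(p : 'I_n * 'I_n) `|a p.1 * a p.2|.
Proof. by rewrite ger0_norm ?trigpow_ge0// trigpow_le. Qed.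

Lemma integrable_weight_trigpowM n (x : 'I_n -> 'I_d -> R) a
    (m : d.-tuple T -> R) (M : R) :
  measurable_fun setT m -> (forall w, `|m w| <= M) ->
  (lebesgue_tuple R d).-integrable setT
    (EFin \o (fun w => g w * (trigpow x a w * m w))).
Proof.
move=> mm mM; apply: (@integrable_weightM _ (\sum_(p : 'I_n * 'I_n) `|a p.1 * a p.2| * M)).
  by apply: measurable_funM => //; exact: measurable_trigpow.
move=> w; rewrite normrM -mulr_suml; apply: ler_pM => //; exact: trigpow_norm.
Qed.

Lemma integrable_weight_trigpow n (x : 'I_n -> 'I_d -> R) a :
  (lebesgue_tuple R d).-integrable setT (EFin \o (fun w => g w * trigpow x a w)).
Proof.
apply: (integrable_weightM (measurable_trigpow x a)) => w; exact: trigpow_norm.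
Qed.

Lemma integrable_tent_trigpow n r (x : 'I_n -> 'I_d -> R) a : 0 < r ->
  (lebesgue_tuple R d).-integrable setT (EFin \o (fun w => tent r w * trigpow x a w)).
Proof. by move=> r0; exact: integrable_tent_trigsum. Qed.

(** On the support of the tent [nsq w <= d * r^2], and elsewhere there is nothing
    to prove but [0 <= g w]. *)
Lemma weight_ge_tent r (w : d.-tuple T) : 0 < r ->
  cP * (1 + d%:R * r ^+ 2) `^ (- tau) * tent r w <= g w.
Proof.
move=> r0; have [wr|] := boolP [forall l, `|tnth w l| <= r].
  apply: le_trans (g_lb w).
  apply: (@le_trans _ _ (cP * (1 + d%:R * r ^+ 2) `^ (- tau))).
    by rewrite ler_piMr ?tent_le1// mulr_ge0 ?powR_ge0// ltW.
  rewrite ler_pM2l//; apply: powRN_le; last exact: ltW.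
    by rewrite (lt_le_trans ltr01)// lerDl nsq_ge0.
  by rewrite lerD2l; apply: nsq_le; exact/forallP.
rewrite negb_forall => /existsP[l]; rewrite -ltNge => rw.
by rewrite (tent_eq0 r0 (ltW rw)) mulr0 weight_ge0.
Qed.

(** At the smallest admissible scale [r = L / h] the weight is at least a multiple
    of [r^(- 2 tau)] on the support of the tent, and the tent sees a mass of
    [r^d |a|^2 / 2].  The bound [H] on [h] absorbs the [1] in [1 + |w|^2]. *)
Lemma weight_trigpow_lower (H : R) : 0 < H -> exists2 c : R, 0 < c &
  forall n h (x : 'I_n -> 'I_d -> R) a, 0 < h -> h <= H -> coord_separated h x ->
  c * h `^ (2 * tau - d%:R) * \sum_i a i ^+ 2 <=
  \int[lebesgue_tuple R d]_w (g w * trigpow x a w).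
Proof.
move=> H0; pose L : R := 8 ^+ d.+1.
have L0 : 0 < L by rewrite exprn_gt0.
pose C0 := (H / L) ^+ 2 + d%:R.
have C00 : 0 < C0 by rewrite ltr_pwDl// exprn_gt0// divr_gt0.
exists (cP * C0 `^ (- tau) * L `^ (d%:R - 2 * tau) / 2).
  by rewrite divr_gt0// !mulr_gt0// powR_gt0.
move=> n h x a h0 hH sep; pose r := L / h.
have r0 : 0 < r by exact: divr_gt0.
have /andP[lb _] := tent_trigpow_bounds a h0 sep (lexx r).
pose e := cP * (1 + d%:R * r ^+ 2) `^ (- tau).
have e0 : 0 <= e by rewrite mulr_ge0 ?powR_ge0// ltW.
apply: (@le_trans _ _ (e * (r ^+ d * (\sum_i a i ^+ 2) / 2))); last first.
  apply: le_trans (ler_wpM2l e0 lb) _.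
  rewrite -RintegralZl//; last exact: integrable_tent_trigpow.
  apply: le_Rintegral => //.
  - have := integrableZl measurableT e (integrable_tent_trigpow x a r0).
    by apply: eq_integrable.
  - exact: integrable_weight_trigpow.
  - move=> w _ ; rewrite mulrA; apply: ler_wpM2r; first exact: trigpow_ge0.
    exact: weight_ge_tent.
have A0 : 0 <= \sum_i a i ^+ 2 by apply: sumr_ge0 => i _; exact: sqr_ge0.
rewrite mulrA mulrA -[leLHS]mulrA [leRHS]mulrAC.
have -> : cP * C0 `^ (- tau) * L `^ (d%:R - 2 * tau) / 2 *
    (h `^ (2 * tau - d%:R) * \sum_i a i ^+ 2) =
    cP * (C0 `^ (- tau) * (L `^ (d%:R - 2 * tau) * h `^ (2 * tau - d%:R))) / 2 * \sum_i a i ^+ 2.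
  by ring.
apply: ler_wpM2r => //; rewrite ler_pM2r ?invr_gt0// /e -!mulrA ler_pM2l//.
have -> : C0 `^ (- tau) * (L `^ (d%:R - 2 * tau) * h `^ (2 * tau - d%:R)) =
   (C0 * r ^+ 2) `^ (- tau) * r ^+ d.
  have Cr0 : 0 < C0 * r ^+ 2 by rewrite mulr_gt0// exprn_gt0.
  rewrite -(powR_mulrn d (ltW r0)) !(powR_expR _ C00) !(powR_expR _ L0).
  rewrite !(powR_expR _ h0) !(powR_expR _ r0) !(powR_expR _ Cr0) -!expRD.
  congr expR; rewrite lnM ?posrE ?exprn_gt0// lnXn// /r ln_div ?posrE//; ring.
apply: ler_wpM2r; first by rewrite exprn_ge0// ltW.
apply: powRN_le; last exact: ltW.
  by rewrite ltr_pwDl// mulr_ge0// sqr_ge0.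
rewrite mulrDl lerD2r -exprMn exprn_ege1//.
by rewrite /r mulrA divfK ?gt_eqF// ler_pdivlMr// mul1r.
Qed.

Definition outside (N : R) : set (d.-tuple T) :=
  [set w | exists l, N < `|tnth w l|].

Lemma measurable_outside N : measurable (outside N).
Proof.
rewrite (_ : outside N = \bigcup_(l in [set: 'I_d])
    ((fun t : d.-tuple T => tnth t l) @^-1` ((fun u : T => `|u|) @^-1` `]N, +oo[%classic))).
  apply: fin_bigcup_measurable => // l _.
  rewrite -[X in measurable X]setTI; apply: measurable_tnth => //.
  by rewrite -[X in measurable X]setTI; exact: normr_measurable.
apply/seteqP; split => w /=.
  by move=> [l lw]; exists l => //=; rewrite in_itv /= lw.
by move=> [l _ /=]; rewrite in_itv /= andbT => lw; exists l.
Qed.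

Lemma integrable_tail n N (x : 'I_n -> 'I_d -> R) a :
  (lebesgue_tuple R d).-integrable setT
    (EFin \o (fun w => g w * (trigpow x a w * \1_(outside N) w))).
Proof.
apply: (@integrable_weight_trigpowM _ _ _ _ 1).
  by apply: measurable_indic; exact: measurable_outside.
by move=> w; rewrite ger0_norm// indicE; case: (_ \in _).
Qed.

(** An upper bound for [g * trigpow] on the shell where the largest coordinate
    lies between [2^k N] and [2^(k+1) N]: there the weight is at most
    [CP (2^k N)^(- 2 tau)] and the tent of twice the outer width is at least
    [2^(- d)]. *)
Definition shell_term n (x : 'I_n -> 'I_d -> R) a (N : R) (k : nat)
    (w : d.-tuple T) : R :=
  CP * (2 ^+ k * N) `^ (- (2 * tau)) * 2 ^+ d *
  (tent (4 * (2 ^+ k * N)) w * trigpow x a w).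

Lemma shell_term_ge0 n (x : 'I_n -> 'I_d -> R) a N k w : 0 <= shell_term x a N k w.
Proof.
by rewrite mulr_ge0 ?(mulr_ge0 (tent_ge0 _ _) (trigpow_ge0 _ _ _))//
  !mulr_ge0 ?exprn_ge0 ?powR_ge0// ltW.
Qed.

(** The shell of [w] is the least [k] with all coordinates at most [2^(k+1) N] in
    absolute value. *)
Lemma tail_le_shell n (x : 'I_n -> 'I_d -> R) a (N : R) (w : d.-tuple T) : 0 < N ->
  outside N w -> exists k, g w * trigpow x a w <= shell_term x a N k w.
Proof.
move=> N0 [l0 Nw].
pose P k := [forall l, `|tnth w l| <= 2 ^+ k.+1 * N].
have exP : exists k, P k.
  have S0 : 0 <= \sum_l `|tnth w l| / N by apply: sumr_ge0 => l _; rewrite divr_ge0// ltW.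
  exists (Num.Def.archi_bound (\sum_l `|tnth w l| / N)); apply/forallP => l.
  rewrite -ler_pdivrMr//.
  apply: (@le_trans _ _ (\sum_l `|tnth w l| / N)).
    by rewrite (bigD1 l)//= lerDl sumr_ge0// => i _; rewrite divr_ge0// ltW.
  apply: le_trans (ltW (archi_boundP S0)) _.
  rewrite -natrX ler_nat; apply: leq_trans (ltnW (ltn_expl _ (ltnSn 1))) _.
  by rewrite leq_exp2l.
pose k := ex_minn exP; have Pk : P k by rewrite /k; case: ex_minnP.
have [l lk] : exists l, 2 ^+ k * N <= `|tnth w l|.
  rewrite /k; case: ex_minnP => -[|m] Pm mmin.
    by exists l0; rewrite expr0 mul1r ltW.
  have : ~~ P m by apply/negP => /mmin; rewrite ltnn.
  by rewrite negb_forall => /existsP[l]; rewrite -ltNge => /ltW; exists l.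
exists k; pose M := 2 ^+ k * N; have M0 : 0 < M by rewrite mulr_gt0// exprn_gt0.
rewrite /shell_term -/M mulrA; apply: ler_wpM2r; first exact: trigpow_ge0.
have gM : g w <= CP * M `^ (- (2 * tau)).
  apply: le_trans (g_ub w) _; rewrite ler_pM2l//.
  have -> : - (2 * tau) = 2%:R * - tau by ring.
  rewrite powRrM powR_mulrn ?(ltW M0)//.
  apply: powRN_le; [exact: exprn_gt0| |exact: ltW].
  by apply: le_trans (nsq_ge (ltW M0) lk) _; rewrite lerDr.
apply: le_trans gM _; rewrite -[leRHS]mulrA ler_peMr//.
  by rewrite mulr_ge0 ?powR_ge0// ltW.
have M40 : 0 < 4 * M by rewrite mulr_gt0.
have T2 := @tent_ge_half R (4 * M) d w M40.
apply: (@le_trans _ _ (2 ^+ d * 2^-1 ^+ d)).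
  by rewrite -exprMn divff// expr1n.
rewrite ler_pM2l ?exprn_gt0//; apply: T2 => l'.
have -> : 4 * M / 2 = 2 ^+ k.+1 * N by rewrite /M exprS; field.
exact: (forallP Pk).
Qed.

(** The shells contribute a geometric series of ratio [2^(d - 2 tau)], which
    converges because [d < 2 tau]. *)
Lemma weight_trigpow_tail : exists2 C : R, 0 < C &
  forall n h (x : 'I_n -> 'I_d -> R) a N, 0 < h -> coord_separated h x ->
  8 ^+ d.+1 / h <= N ->
  \int[lebesgue_tuple R d]_w (g w * (trigpow x a w * \1_(outside N) w)) <=
  C * N `^ (d%:R - 2 * tau) * \sum_i a i ^+ 2.
Proof.
pose q : R := 2 `^ (d%:R - 2 * tau).
have q0 : 0 < q by exact: powR_gt0.
have q1 : q < 1.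
  have dt : d%:R - 2 * tau < 0 by move: tau_gt; lra.
  by rewrite /q powR_expR// -[ltRHS]expR0 ltr_expR nmulr_rlt0 ?ln_gt0 ?ltr1n.
exists (CP * 2 ^+ d * 2 * 4 ^+ d / (1 - q)).
  by rewrite divr_gt0 ?subr_gt0// !mulr_gt0// exprn_gt0.
move=> n h x a N h0 sep NL.
have N0 : 0 < N by apply: lt_le_trans NL; rewrite divr_gt0// exprn_gt0.
set A := \sum_i _; have A0 : 0 <= A by apply: sumr_ge0 => i _; exact: sqr_ge0.
pose B := CP * 2 ^+ d * 2 * 4 ^+ d * N `^ (d%:R - 2 * tau) * A.
have B0 : 0 <= B.
  rewrite /B; apply: mulr_ge0 => //; apply: mulr_ge0; last exact: powR_ge0.
  by rewrite !mulr_ge0 ?exprn_ge0// ltW.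
have -> : CP * 2 ^+ d * 2 * 4 ^+ d / (1 - q) * N `^ (d%:R - 2 * tau) * A =
    B / (1 - q) by rewrite /B; ring.
pose s k := \int[lebesgue_tuple R d]_w shell_term x a N k w.
have M0 k : 0 < 2 ^+ k * N by rewrite mulr_gt0// exprn_gt0.
have M40 k : 0 < 4 * (2 ^+ k * N) by rewrite mulr_gt0.
have is_ k : (lebesgue_tuple R d).-integrable setT (EFin \o shell_term x a N k).
  have := integrableZl measurableT (CP * (2 ^+ k * N) `^ (- (2 * tau)) * 2 ^+ d)
    (integrable_tent_trigpow x a (M40 k)).
  by apply: eq_integrable.
have sB k : s k <= B * q ^+ k.
  rewrite /s /shell_term RintegralZl//; last exact: integrable_tent_trigpow.
  have NM : N <= 2 ^+ k * N by rewrite ler_peMl ?(ltW N0)// exprn_ege1// ler1n.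
  have N4 : 8 ^+ d.+1 / h <= 4 * (2 ^+ k * N).
    apply: le_trans NL (le_trans NM _).
    by rewrite ler_peMl ?(ltW (M0 k))// ler1n.
  have /andP[_ ub] := tent_trigpow_bounds a h0 sep N4.
  apply: le_trans (ler_wpM2l _ ub) _.
    by rewrite !mulr_ge0 ?powR_ge0 ?exprn_ge0// ltW.
  rewrite -/A /B le_eqVlt; apply/orP; left; apply/eqP.
  have -> : N `^ (d%:R - 2 * tau) = N `^ (- (2 * tau)) * N ^+ d.
    by rewrite -(powR_mulrn d (ltW N0)) !(powR_expR _ N0) -expRD; congr expR; ring.
  have -> : q ^+ k = (2 ^+ k) `^ (- (2 * tau)) * (2 ^+ k) ^+ d.
    have k0 : 0 < 2 ^+ k :> R by rewrite exprn_gt0.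
    rewrite -(powR_mulrn d (ltW k0)) !(powR_expR _ k0) -expRD.
    rewrite -(powR_mulrn k (ltW q0)) powR_expR// /q ln_powR lnXn//.
    by congr expR; ring.
  rewrite powRM ?exprn_ge0 ?(ltW N0)// !exprMn; ring.
have F0 w : 0 <= g w * (trigpow x a w * \1_(outside N) w).
  by rewrite !mulr_ge0 ?weight_ge0 ?trigpow_ge0// indicE.
have key : (\int[lebesgue_tuple R d]_w
    (g w * (trigpow x a w * \1_(outside N) w))%:E <= (B / (1 - q))%:E)%E.
  apply: (@le_trans _ _ (\int[lebesgue_tuple R d]_w
      (\sum_(0 <= k <oo) (shell_term x a N k w)%:E))%E).
    apply: ge0_le_integral => //.
    - by move=> w _; rewrite lee_fin F0.
    - by case/integrableP: (integrable_tail N x a).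
    - apply: ge0_emeasurable_sum => k *; first by rewrite lee_fin shell_term_ge0.
      by case/integrableP: (is_ k).
    - move=> w _; rewrite indicE; case: (boolP (w \in _)) => [|_]; last first.
        by rewrite !mulr0; apply: nneseries_ge0 => k _ _; rewrite lee_fin shell_term_ge0.
      rewrite inE => /(tail_le_shell x a N0)[k gk]; rewrite mulr1.
      apply: le_trans (nneseries_lim_ge k.+1 _).
        rewrite sumEFin lee_fin big_nat_recr //=; apply: ler_wpDl => //.
        by apply: sumr_ge0 => i _; exact: shell_term_ge0.
      by move=> i _ _; rewrite lee_fin shell_term_ge0.
  rewrite integral_nneseries//; last 2 first.
  - by move=> k; case/integrableP: (is_ k).
  - by move=> k w _; rewrite lee_fin shell_term_ge0.
  have sE k : (\int[lebesgue_tuple R d]_w (shell_term x a N k w)%:E = (s k)%:E)%E.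
    by rewrite /s /Rintegral fineK//; apply: integrable_fin_num => //; exact: is_.
  under eq_eseriesr do rewrite sE.
  apply: lime_le.
    apply: is_cvg_nneseries => k _ _; rewrite lee_fin.
    by apply: Rintegral_ge0 => w _; exact: shell_term_ge0.
  apply: nearW => m; rewrite sumEFin lee_fin big_mkord.
  apply: (@le_trans _ _ (\sum_(k < m) B * q ^+ k)); first by apply: ler_sum => k _; exact: sB.
  rewrite -mulr_sumr; apply: ler_wpM2l => //.
  by apply: geometric_sum_le => //; exact: ltW.
rewrite /Rintegral -[leRHS]/(fine (B / (1 - q))%:E); apply: fine_le => //.
by apply: integrable_fin_num => //; exact: integrable_tail.
Qed.

End weight.

(** * The deficit caused by a shift *)

Section Rintegral_linear.
Context d (T : measurableType d) (R : realType) (mu : {measure set T -> \bar R}).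

Lemma integrable_lin2 (c1 c2 : R) (f1 f2 : T -> R) :
  mu.-integrable setT (EFin \o f1) -> mu.-integrable setT (EFin \o f2) ->
  mu.-integrable setT (EFin \o (fun w => c1 * f1 w + c2 * f2 w)).
Proof.
move=> i1 i2; have := integrableD measurableT
  (integrableZl measurableT c1 i1) (integrableZl measurableT c2 i2).
by apply: eq_integrable.
Qed.

Lemma Rintegral_lin2 (c1 c2 : R) (f1 f2 : T -> R) :
  mu.-integrable setT (EFin \o f1) -> mu.-integrable setT (EFin \o f2) ->
  \int[mu]_w (c1 * f1 w + c2 * f2 w) = c1 * \int[mu]_w f1 w + c2 * \int[mu]_w f2 w.
Proof.
move=> i1 i2.
have j1 : mu.-integrable setT (EFin \o (fun w => c1 * f1 w)).
  by have := integrableZl measurableT c1 i1; apply: eq_integrable.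
have j2 : mu.-integrable setT (EFin \o (fun w => c2 * f2 w)).
  by have := integrableZl measurableT c2 i2; apply: eq_integrable.
by rewrite RintegralD// !RintegralZl.
Qed.

End Rintegral_linear.

Section estimates.
Context {R : realType}.
Local Notation T := (measurableTypeR R).

(** Cauchy-Schwarz, through Lagrange's identity. *)
Lemma tdot_sqr_le d (w : d.-tuple T) (b : 'I_d -> R) :
  tdot w b ^+ 2 <= nsq w * \sum_l b l ^+ 2.
Proof.
have : 0 <= \sum_i \sum_j (tnth w i * b j - tnth w j * b i) ^+ 2.
  by apply: sumr_ge0 => i _; apply: sumr_ge0 => j _; exact: sqr_ge0.
have -> : \sum_i \sum_j (tnth w i * b j - tnth w j * b i) ^+ 2 =
   2 * (nsq w * \sum_l b l ^+ 2) - 2 * tdot w b ^+ 2.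
  have E1 : \sum_i \sum_j (tnth w i ^+ 2 * b j ^+ 2) = nsq w * \sum_l b l ^+ 2.
    by rewrite /nsq big_distrlr.
  have E2 : \sum_i \sum_j ((tnth w i * b i) * (tnth w j * b j)) = tdot w b ^+ 2.
    by rewrite expr2 /tdot big_distrlr.
  have E3 : \sum_i \sum_j (tnth w j ^+ 2 * b i ^+ 2) = nsq w * \sum_l b l ^+ 2.
    by rewrite exchange_big /= E1.
  have -> : 2 * (nsq w * \sum_l b l ^+ 2) =
      nsq w * \sum_l b l ^+ 2 + nsq w * \sum_l b l ^+ 2 by ring.
  rewrite -{1}E1 -E3 -E2 -big_split mulr_sumr -sumrB /=; apply: eq_bigr => i _.
  rewrite -big_split mulr_sumr -sumrB /=; apply: eq_bigr => j _; ring.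
lra.
Qed.

Context (d : nat) (tau cP CP : R) (g : d.-tuple T -> R).
Context (tau_gt : d%:R / 2 < tau) (cP0 : 0 < cP) (CP0 : 0 < CP).
Context (g_int : (lebesgue_tuple R d).-integrable setT (EFin \o g)).
Context (g_lb : forall w, cP * (1 + nsq w) `^ (- tau) <= g w).
Context (g_ub : forall w, g w <= CP * (1 + nsq w) `^ (- tau)).

Let g_ge0 w : 0 <= g w.
Proof. exact: (weight_ge0 cP0 g_lb). Qed.

Section points.
Context (n : nat) (x : 'I_n -> 'I_d -> R) (a : 'I_n -> R) (b : 'I_d -> R).

Local Notation mu := (lebesgue_tuple R d).
Local Notation psi := (trigpow x a).
Local Notation energy := (\int[mu]_w (g w * psi w)).
Local Notation deficit := (\int[mu]_w (g w * (psi w * (1 - cos (tdot w b))))).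
Local Notation tail N := (\int[mu]_w (g w * (psi w * \1_(outside N) w))).

Lemma measurable_one_sub_cos :
  measurable_fun setT (fun w : d.-tuple T => 1 - cos (tdot w b)).
Proof.
apply: measurable_funB; first exact: measurable_cst.
by apply: measurable_cosf; exact: measurable_tdot.
Qed.

Lemma integrable_deficit :
  mu.-integrable setT (EFin \o (fun w => g w * (psi w * (1 - cos (tdot w b))))).
Proof.
apply: (integrable_weight_trigpowM g_int _ _ measurable_one_sub_cos (M := 2)) => w.
by have := cos_le1 (tdot w b); have := cos_geN1 (tdot w b); rewrite ler_norml; lra.
Qed.

(** Above the frequency [N] use [1 - cos <= 2], below it
    [1 - cos (w.b) <= (w.b)^2 / 2] and Cauchy-Schwarz. *)
Lemma deficit_le_split N : 0 < N ->
  deficit <= d%:R * N ^+ 2 * (\sum_l b l ^+ 2) / 2 * energy + 2 * tail N.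
Proof.
move=> N0; rewrite -Rintegral_lin2; last 2 first.
- exact: integrable_weight_trigpow.
- exact: integrable_tail.
apply: le_Rintegral => //.
- exact: integrable_deficit.
- by apply: integrable_lin2; [exact: integrable_weight_trigpow|exact: integrable_tail].
move=> w _.
have gp : 0 <= g w * psi w by rewrite mulr_ge0 ?trigpow_ge0.
have b0 : 0 <= \sum_l b l ^+ 2 by apply: sumr_ge0 => l _; exact: sqr_ge0.
rewrite !(mulrA (g w)) indicE; case: (boolP (w \in _)) => [_|].
  rewrite mulr1; apply: ler_wpDl.
    by rewrite mulr_ge0// divr_ge0// mulr_ge0// mulr_ge0// sqr_ge0.
  rewrite [leRHS]mulrC; apply: ler_wpM2l => //.
  by have := cos_geN1 (tdot w b); lra.
rewrite notin_setE => /forallNP wN; rewrite !mulr0 addr0 [leRHS]mulrC.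
apply: ler_wpM2l => //; apply: le_trans (one_sub_cos_le _) _.
rewrite ler_pM2r ?invr_gt0//; apply: le_trans (tdot_sqr_le _ _) _.
apply: ler_wpM2r => //; apply: nsq_le => l.
by rewrite leNgt; apply/negP; exact: wN.
Qed.

(** The weight [nsq * g] is at most [th * g] where [nsq <= th] and, as [tau > 1],
    at most [CP * th^(1 - tau)] elsewhere. *)
Lemma nsq_weight_le th (w : d.-tuple T) : 1 < tau -> 0 < th ->
  nsq w * g w <= th * g w + th `^ (1 - tau) * CP.
Proof.
move=> tau1 th0; case: (leP (nsq w) th) => [wth|thw].
  apply: ler_wpDr; first by rewrite mulr_ge0 ?powR_ge0// ltW.
  exact: ler_wpM2r.
apply: ler_wpDl; first by rewrite mulr_ge0// ltW.
have n0 : 0 < 1 + nsq w by rewrite ltr_pwDl// nsq_ge0.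
apply: le_trans (ler_wpM2l (nsq_ge0 w) (g_ub w)) _.
rewrite mulrCA mulrC ler_pM2r//.
apply: (@le_trans _ _ ((1 + nsq w) * (1 + nsq w) `^ (- tau))).
  by rewrite ler_wpM2r ?powR_ge0// lerDr.
rewrite -[X in X * _](powRr1 (ltW n0)) -powRD; last by apply/implyP => _; rewrite gt_eqF.
rewrite (_ : 1 - tau = - (tau - 1)); last by ring.
by apply: powRN_le; lra.
Qed.

(** Below the frequency [N] the factor [|w|^2] is kept and [nsq_weight_le] is
    applied.  The parameter [th] is free: its optimal choice gives the bound of
    Hoelder's inequality up to a factor. *)
Lemma deficit_le_young N th : 1 < tau -> 0 < N -> 0 < th ->
  deficit <= (\sum_l b l ^+ 2) / 2 *
    (th * energy + th `^ (1 - tau) * CP * 2 ^+ d *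
      \int[mu]_w (tent (2 * N) w * psi w)) + 2 * tail N.
Proof.
move=> tau1 N0 th0; have N20 : 0 < 2 * N by rewrite mulr_gt0.
have i1 := integrable_weight_trigpow g_int x a.
have i2 := integrable_tent_trigpow x a N20.
rewrite -Rintegral_lin2// -Rintegral_lin2//; last 2 first.
- exact: integrable_lin2.
- exact: integrable_tail.
apply: le_Rintegral => //.
- exact: integrable_deficit.
- by apply: integrable_lin2; [exact: integrable_lin2|exact: integrable_tail].
move=> w _.
have p0 : 0 <= psi w by exact: trigpow_ge0.
have gp : 0 <= g w * psi w by rewrite mulr_ge0.
have b0 : 0 <= \sum_l b l ^+ 2 by apply: sumr_ge0 => l _; exact: sqr_ge0.
rewrite !(mulrA (g w)) indicE; case: (boolP (w \in _)) => [_|].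
  rewrite mulr1; apply: ler_wpDl.
    apply: mulr_ge0; first exact: divr_ge0.
    apply: addr_ge0; first by apply: mulr_ge0 => //; exact: ltW.
    apply: mulr_ge0; last by rewrite mulr_ge0 ?tent_ge0.
    by rewrite mulr_ge0 ?exprn_ge0// mulr_ge0 ?powR_ge0// ltW.
  rewrite [leRHS]mulrC; apply: ler_wpM2l => //.
  by have := cos_geN1 (tdot w b); lra.
rewrite notin_setE => /forallNP wN; rewrite !mulr0 addr0.
apply: le_trans (ler_wpM2l gp (one_sub_cos_le _)) _.
apply: (@le_trans _ _ ((\sum_l b l ^+ 2) / 2 * (nsq w * g w * psi w))).
  have -> : (\sum_l b l ^+ 2) / 2 * (nsq w * g w * psi w) =
    g w * psi w * (nsq w * (\sum_l b l ^+ 2) / 2) by ring.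
  by apply: ler_wpM2l => //; rewrite ler_pM2r ?invr_gt0// tdot_sqr_le.
apply: ler_wpM2l; first by rewrite mulr_ge0 ?invr_ge0.
have -> : th * (g w * psi w) + th `^ (1 - tau) * CP * 2 ^+ d * (tent (2 * N) w * psi w)
  = (th * g w + th `^ (1 - tau) * CP * (2 ^+ d * tent (2 * N) w)) * psi w by ring.
apply: ler_wpM2r => //; apply: le_trans (nsq_weight_le w tau1 th0) _.
rewrite lerD2l ler_peMr ?mulr_ge0 ?powR_ge0 ?(ltW CP0)//.
apply: (@le_trans _ _ (2 ^+ d * 2^-1 ^+ d)).
  by rewrite -exprMn divff// expr1n.
rewrite ler_pM2l ?exprn_gt0//; apply: tent_ge_half => // l.
by rewrite mulrAC divff// mul1r leNgt; apply/negP; exact: wN.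
Qed.

(** The weight dominates a positive multiple of the tent supplied by
    [tent_trigpow_shift_gt0]. *)
Lemma deficit_gt0 h : 0 < h -> coord_separated h x ->
  (forall i j (s : bool), exists l, h <= `|x i l - x j l + (-1) ^+ s * b l|) ->
  0 < \sum_i a i ^+ 2 -> 0 < deficit.
Proof.
move=> h0 sep sepb A0.
have [r r0 I0] := tent_trigpow_shift_gt0 h0 sep sepb A0.
pose e := cP * (1 + d%:R * r ^+ 2) `^ (- tau).
have e0 : 0 < e.
  by rewrite mulr_gt0// powR_gt0// ltr_pwDl// mulr_ge0// sqr_ge0.
have it : mu.-integrable setT
    (EFin \o (fun w => tent r w * (psi w * (1 - cos (tdot w b))))).
  pose m (w : d.-tuple T) := psi w * (1 - cos (tdot w b)).
  have mm : measurable_fun setT m.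
    apply: measurable_funM; first exact: measurable_trigpow.
    exact: measurable_one_sub_cos.
  have bm : [bounded m w | w in [set: d.-tuple T]].
    exists (\sum_(p : 'I_n * 'I_n) `|a p.1 * a p.2| * 2); split; first exact: num_real.
    move=> y My w _ /=; apply: le_trans (ltW My).
    rewrite normrM -mulr_suml; apply: ler_pM => //; first exact: trigpow_norm.
    by have := cos_le1 (tdot w b); have := cos_geN1 (tdot w b); rewrite ler_norml; lra.
  have := integrableMl measurableT (integrable_tent d r0) mm bm.
  by apply: eq_integrable.
apply: (lt_le_trans (mulr_gt0 e0 I0)); rewrite -RintegralZl//.
apply: le_Rintegral => //.
- by have := integrableZl measurableT e it; apply: eq_integrable.
- exact: integrable_deficit.
- move=> w _; rewrite mulrA; apply: ler_wpM2r.
    by rewrite mulr_ge0 ?trigpow_ge0// subr_ge0 cos_le1.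
  exact: weight_ge_tent.
Qed.

End points.
End estimates.

(** * Bounds for the deficit that are uniform in the points *)

Section core.
Context {R : realType}.
Local Notation T := (measurableTypeR R).

(** Solve [C * M^(- p) = e] for [M], and increase the solution to [1] if
    necessary. *)
Lemma exists_small_powRN (C p e : R) : 0 < C -> 0 < p -> 0 < e ->
  exists2 M, 1 <= M & C * M `^ (- p) <= e.
Proof.
move=> C0 p0 e0; pose y := (C / e) `^ p^-1.
have Ce : 0 < C / e by exact: divr_gt0.
have y0 : 0 < y by exact: powR_gt0.
exists (Num.max 1 y); first by rewrite le_max lexx.
apply: (@le_trans _ _ (C * y `^ (- p))).
  rewrite ler_pM2l//; apply: powRN_le => //; last exact: ltW.
  by rewrite le_max lexx orbT.
rewrite /y -powRrM mulrN mulVf ?gt_eqF// powR_inv1 ?(ltW Ce)//.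
by rewrite invf_div mulrCA divff ?mulr1// gt_eqF.
Qed.

Context (d : nat) (tau cP CP : R) (g : d.-tuple T -> R).
Context (tau_gt : d%:R / 2 < tau) (cP0 : 0 < cP) (CP0 : 0 < CP).
Context (g_int : (lebesgue_tuple R d).-integrable setT (EFin \o g)).
Context (g_lb : forall w, cP * (1 + nsq w) `^ (- tau) <= g w).
Context (g_ub : forall w, g w <= CP * (1 + nsq w) `^ (- tau)).

Let tau0 : 0 < tau.
Proof. by apply: le_lt_trans tau_gt; rewrite divr_ge0. Qed.

(** The order of the choices matters: first [M], so that the tail above
    [N = M L / h] is negligible; then [c], depending on [M], so that the
    frequencies below [N] hardly see the shift. *)
Lemma deficit_bounds (H z : R) : 0 < H -> 0 < z -> exists2 c, 0 < c &
  forall n h (x : 'I_n -> 'I_d -> R) a b, 0 < h -> h <= H -> coord_separated h x ->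
  0 < \sum_i a i ^+ 2 -> \sum_l b l ^+ 2 <= c * h ^+ 2 ->
  let A := \sum_i a i ^+ 2 in
  let energy := \int[lebesgue_tuple R d]_w (g w * trigpow x a w) in
  let deficit := \int[lebesgue_tuple R d]_w
    (g w * (trigpow x a w * (1 - cos (tdot w b)))) in
  deficit <= energy / 4 /\
  (1 < tau -> deficit / A <=
     z * ((energy / A) `^ (1 - 1 / tau) * h `^ (2 - d%:R / tau))).
Proof.
move=> H0 z0.
have [al al0 low] := weight_trigpow_lower tau_gt cP0 g_int g_lb H0.
have [C C0 tl] := weight_trigpow_tail tau_gt cP0 CP0 g_int g_lb g_ub.
pose L : R := 8 ^+ d.+1.
have L0 : 0 < L by rewrite exprn_gt0.
(* The first entry serves the bound by [energy / 4], the second the one for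
   [tau > 1]. *)
pose eta := Num.min (al / 16) (z * al `^ (1 - 1 / tau) / 4).
have eta0 : 0 < eta.
  by rewrite lt_min !divr_gt0//= mulr_gt0// powR_gt0.
have p0 : 0 < 2 * tau - d%:R by move: tau_gt; lra.
have [M M1 MC] := exists_small_powRN (mulr_gt0 C0 (powR_gt0 (- (2 * tau - d%:R)) L0)) p0 eta0.
have M0 : 0 < M by apply: lt_le_trans M1.
pose C3 := CP * 2 ^+ d * (2 * (2 * (M * L)) ^+ d).
have ML0 : 0 < M * L by exact: mulr_gt0.
have C30 : 0 < C3 by rewrite !mulr_gt0 ?exprn_gt0// mulr_gt0.
pose c1 := (4 * (1 + d%:R) * (M * L) ^+ 2)^-1.
have d1 : 0 < 1 + d%:R :> R by rewrite ltr_pwDl.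
have c10 : 0 < c1.
  by rewrite invr_gt0 mulr_gt0 ?exprn_gt0// mulr_gt0.
pose c2 := z / (1 + C3).
have C31 : 0 < 1 + C3 by rewrite addr_gt0.
have c20 : 0 < c2 by rewrite divr_gt0.
exists (Num.min c1 c2); first by rewrite lt_min c10.
move=> n h x a b h0 hH sep A0 bc A energy deficit.
have bc1 : \sum_l b l ^+ 2 <= c1 * h ^+ 2.
  apply: le_trans bc _; apply: ler_wpM2r; first exact: sqr_ge0.
  by rewrite ge_min lexx.
have bc2 : \sum_l b l ^+ 2 <= c2 * h ^+ 2.
  apply: le_trans bc _; apply: ler_wpM2r; first exact: sqr_ge0.
  by rewrite ge_min lexx orbT.
have b0 : 0 <= \sum_l b l ^+ 2 by apply: sumr_ge0 => l _; exact: sqr_ge0.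
set B := \sum_l b l ^+ 2 in b0 bc bc1 bc2 *.
pose s := h `^ (2 * tau - d%:R).
have s0 : 0 < s by exact: powR_gt0.
have lowE : al * s * A <= energy := low n h x a h0 hH sep.
have E0 : 0 < energy by apply: lt_le_trans lowE; rewrite !mulr_gt0.
pose N := M * L / h.
have N0 : 0 < N by exact: divr_gt0.
have LN : L / h <= N by rewrite ler_pM2r ?invr_gt0// ler_peMl// ltW.
pose tail := \int[lebesgue_tuple R d]_w
  (g w * (trigpow x a w * \1_(outside N) w)).
have tailE : tail <= eta * s * A.
  apply: le_trans (tl n h x a N h0 sep LN) _; rewrite ler_pM2r//.
  have -> : C * N `^ (d%:R - 2 * tau) =
      C * L `^ (- (2 * tau - d%:R)) * M `^ (- (2 * tau - d%:R)) * s.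
    rewrite -!mulrA; congr (_ * _).
    rewrite /s !(powR_expR _ N0) !(powR_expR _ L0) !(powR_expR _ M0) !(powR_expR _ h0).
    rewrite -!expRD; congr expR.
    rewrite /N ln_div ?posrE// lnM ?posrE//; ring.
  by rewrite ler_pM2r.
have sA0 : 0 < s * A by exact: mulr_gt0.
split.
  apply: le_trans (deficit_le_split cP0 g_int g_lb x a b N0) _.
  rewrite -/energy -/tail -/B.
  have t8 : 2 * tail <= energy / 8.
    have : eta * (s * A) <= al / 16 * (s * A).
      by rewrite ler_pM2r// ge_min lexx.
    rewrite mulrA => e1; move: lowE tailE e1; rewrite -!mulrA; lra.
  have q8 : d%:R * N ^+ 2 * B / 2 <= 1 / 8.
    have : (d%:R * N ^+ 2) * B <= (d%:R * N ^+ 2) * (c1 * h ^+ 2).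
      by apply: ler_wpM2l => //; rewrite mulr_ge0// sqr_ge0.
    have -> : d%:R * N ^+ 2 * (c1 * h ^+ 2) = (d%:R / (1 + d%:R)) / 4.
      by rewrite /N /c1; field; rewrite !gt_eqF// -natr1 addrC.
    have : d%:R / (1 + d%:R) <= 1 :> R by rewrite ler_pdivrMr// mul1r lerDr.
    lra.
  have := ler_wpM2r (ltW E0) q8; lra.
move=> tau1.
have EA0 : 0 < energy / A by exact: divr_gt0.
set E := energy / A in EA0 *.
have Es : al * s <= E by rewrite ler_pdivlMr.
(* This cut balances the two terms of [deficit_le_young]: [th * E] and
   [th^(1 - tau) * h^(- d)] are both equal to [Z]. *)
pose th := (h `^ (- d%:R) / E) `^ tau^-1.
have hE0 : 0 < h `^ (- d%:R) / E by rewrite divr_gt0// powR_gt0.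
have th0 : 0 < th by exact: powR_gt0.
pose Z := E `^ (1 - 1 / tau) * h `^ (- (d%:R / tau)).
have Z0 : 0 < Z by rewrite mulr_gt0 ?powR_gt0.
have tn0 : tau != 0 by rewrite gt_eqF.
have hd0 : 0 < h `^ (- d%:R) by exact: powR_gt0.
have lnth : ln th = tau^-1 * (- d%:R * ln h - ln E).
  by rewrite /th ln_powR ln_div ?posrE// ln_powR.
have ZE : Z = expR ((1 - 1 / tau) * ln E - d%:R / tau * ln h).
  by rewrite /Z (powR_expR _ EA0) (powR_expR _ h0) -expRD mulNr.
have thE : th * E = Z.
  have E1 y : 0 < y -> y = expR (ln y) :> R by move=> y0; rewrite lnK.
  rewrite [in LHS](E1 _ th0) [in LHS](E1 _ EA0) -expRD lnth ZE; congr expR; field.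
  exact: tn0.
have thE2 : th `^ (1 - tau) * h `^ (- d%:R) = Z.
  rewrite (powR_expR _ th0) (powR_expR _ h0) -expRD lnth ZE; congr expR; field.
  exact: tn0.
have Y2 : E `^ (1 - 1 / tau) * h `^ (2 - d%:R / tau) = h ^+ 2 * Z.
  rewrite -(powR_mulrn 2 (ltW h0)) ZE (powR_expR _ EA0) !(powR_expR _ h0) -!expRD.
  congr expR; ring.
rewrite Y2.
have sZ : al `^ (1 - 1 / tau) * s <= h ^+ 2 * Z.
  have -> : al `^ (1 - 1 / tau) * s = (al * s) `^ (1 - 1 / tau) * h `^ (2 - d%:R / tau).
    rewrite powRM ?(ltW al0) ?(ltW s0)// -mulrA; congr (_ * _).
    rewrite (powR_expR _ s0) /s ln_powR !(powR_expR _ h0) -expRD; congr expR; field.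
    exact: tn0.
  rewrite -Y2; apply: ler_wpM2r; first exact: powR_ge0.
  apply: ge0_ler_powR => //; rewrite ?nnegrE ?(ltW EA0) ?mulr_ge0 ?(ltW al0) ?(ltW s0)//.
  by rewrite subr_ge0 ler_pdivrMr// mul1r ltW.
have N20 : 8 ^+ d.+1 / h <= 2 * N by apply: le_trans LN _; rewrite ler_peMl ?(ltW N0)// ler1n.
have /andP[_ tb] := tent_trigpow_bounds a h0 sep N20.
have := deficit_le_young cP0 CP0 g_int g_lb g_ub x a b tau1 N0 th0.
rewrite -/energy -/deficit -/tail -/B => young.
rewrite ler_pdivrMr//; apply: le_trans young _.
have young2 : th * energy + th `^ (1 - tau) * CP * 2 ^+ d *
    \int[lebesgue_tuple R d]_w (tent (2 * N) w * trigpow x a w) <= (1 + C3) * Z * A.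
  apply: (@le_trans _ _ (th * energy + th `^ (1 - tau) * CP * 2 ^+ d *
      (2 * ((2 * N) ^+ d * A)))).
    rewrite lerD2l; apply: ler_wpM2l => //.
    by rewrite mulr_ge0 ?exprn_ge0// mulr_ge0 ?powR_ge0// ltW.
  have -> : energy = E * A by rewrite /E divfK// gt_eqF.
  have -> : 2 * N = 2 * (M * L) * h^-1 by rewrite /N; ring.
  rewrite exprMn exprVn -(powR_mulrn d (ltW h0)) -powRN.
  have -> : th * (E * A) = Z * A by rewrite mulrA thE.
  have -> : th `^ (1 - tau) * CP * 2 ^+ d *
      (2 * ((2 * (M * L)) ^+ d * h `^ (- d%:R) * A)) =
      C3 * (th `^ (1 - tau) * h `^ (- d%:R)) * A by rewrite /C3; ring.
  by rewrite thE2 -mulrDl -{1}[Z]mul1r -mulrDl.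
have part1 : B / 2 * (th * energy + th `^ (1 - tau) * CP * 2 ^+ d *
    \int[lebesgue_tuple R d]_w (tent (2 * N) w * trigpow x a w)) <=
    z / 2 * (h ^+ 2 * Z) * A.
  apply: le_trans (ler_wpM2l (_ : 0 <= B / 2) young2) _; first exact: divr_ge0.
  have ZA : 0 <= (1 + C3) * Z * A / 2.
    by apply: ltW; apply: divr_gt0 => //; rewrite mulr_gt0// mulr_gt0.
  have := ler_wpM2r ZA bc2.
  have -> : c2 * h ^+ 2 * ((1 + C3) * Z * A / 2) = z / 2 * (h ^+ 2 * Z) * A.
    by rewrite /c2; field; rewrite gt_eqF.
  by apply: le_trans; rewrite le_eqVlt; apply/orP; left; apply/eqP; ring.
have part2 : 2 * tail <= z / 2 * (h ^+ 2 * Z) * A.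
  apply: (@le_trans _ _ (2 * (eta * s * A))); first by rewrite ler_pM2l.
  rewrite [2 * _]mulrA [2 * (_ * s)]mulrA ler_pM2r//.
  apply: (@le_trans _ _ (2 * (z * al `^ (1 - 1 / tau) / 4) * s)).
    by rewrite ler_pM2r// ler_pM2l// ge_min lexx orbT.
  have -> : 2 * (z * al `^ (1 - 1 / tau) / 4) * s = z / 2 * (al `^ (1 - 1 / tau) * s).
    by field.
  by rewrite ler_pM2l// divr_gt0.
have := lerD part1 part2.
by rewrite -mulrDl -mulrDl -splitr.
Qed.

End core.

(** * Kernel matrices *)

Section transfer.
Context {R : realType}.
Local Notation T := (measurableTypeR R).

Lemma enorm_sqr n (u : 'cV[R]_n) : enorm u ^+ 2 = \sum_l u l 0 ^+ 2.
Proof.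
rewrite /enorm sqr_sqrtr; first by apply: eq_bigr => l _; rewrite expr2.
by apply: sumr_ge0 => l _; rewrite -expr2 sqr_ge0.
Qed.

Lemma enorm_ge0 n (u : 'cV[R]_n) : 0 <= enorm u.
Proof. exact: sqrtr_ge0. Qed.

Lemma enorm_gt0 n (u : 'cV[R]_n) : u != 0 -> 0 < enorm u.
Proof.
move=> u0; rewrite lt_neqAle enorm_ge0 andbT eq_sym; apply: contra u0 => /eqP e0.
have := enorm_sqr u; rewrite e0 expr0n /= => /esym/eqP.
rewrite psumr_eq0 => [/allP u2|l _]; last exact: sqr_ge0.
apply/eqP/colP => l; rewrite mxE; apply/eqP.
by have := u2 l (mem_index_enum l); rewrite sqrf_eq0.
Qed.

Lemma coord_le_enorm n (u : 'cV[R]_n) l : `|u l 0| <= enorm u.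
Proof.
rewrite -(@ler_pXn2r _ 2) ?nnegrE ?enorm_ge0// real_normK ?num_real//.
by rewrite enorm_sqr (bigD1 l)//= lerDl sumr_ge0// => k _; exact: sqr_ge0.
Qed.

(** The largest coordinate is at least the quadratic mean of the coordinates. *)
Lemma exists_large_coord d (u : 'cV[R]_d) : (0 < d)%N ->
  exists l, enorm u / Num.sqrt d%:R <= `|u l 0|.
Proof.
move=> d0; apply: contrapT => /forallNP H.
have s0 : 0 < Num.sqrt (d%:R : R) by rewrite sqrtr_gt0 ltr0n.
have : \sum_l u l 0 ^+ 2 < \sum_(l < d) (enorm u / Num.sqrt d%:R) ^+ 2.
  apply: ltr_sum; first by apply/hasP; exists (Ordinal d0); rewrite ?mem_index_enum.
  move=> l _; rewrite -[ltLHS]real_normK ?num_real// ltrXn2r//.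
  by rewrite ltNge; apply/negP; exact: H.
rewrite -enorm_sqr sumr_const card_ord expr_div_n (sqr_sqrtr (ler0n R d)).
by rewrite -[_ *+ d]mulr_natr divfK ?ltxx// gt_eqF// ltr0n.
Qed.

Lemma separation_distance_le d n (x : 'I_n -> 'cV[R]_d) i j : x i != x j ->
  2 * separation_distance x <= enorm (x i - x j).
Proof.
move=> xij; rewrite /separation_distance mulrA divff ?mul1r//.
apply: ge_inf; last by exists i, j.
by exists 0 => _ [k [l [_ ->]]]; exact: enorm_ge0.
Qed.

Lemma separation_distance_bound d n (x : 'I_n -> 'cV[R]_d) (M : R) :
  (2 <= n)%N -> injective x -> (forall i, enorm (x i) <= M) ->
  separation_distance x <= M.
Proof.
case: n x => [|[|n]]// x _ xI xM.
have x01 : x ord0 != x ord_max by apply/eqP => /xI.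
have M0 : 0 <= M by apply: le_trans (xM ord0); exact: enorm_ge0.
have := separation_distance_le x01 => q2.
have : enorm (x ord0 - x ord_max) <= 2 * M.
  rewrite -(@ler_pXn2r _ 2) ?nnegrE ?enorm_ge0 ?mulr_ge0// enorm_sqr exprMn.
  apply: (@le_trans _ _ (2 * enorm (x ord0) ^+ 2 + 2 * enorm (x ord_max) ^+ 2)).
    rewrite !enorm_sqr !mulr_sumr -big_split /=; apply: ler_sum => l _.
    rewrite !mxE; have := sqr_ge0 (x ord0 l 0 + x ord_max l 0); lra.
  have sq i : enorm (x i) ^+ 2 <= M ^+ 2.
    by rewrite lerXn2r ?nnegrE ?enorm_ge0.
  have := sq ord0; have := sq ord_max; lra.
lra.
Qed.

Lemma dotv_tdot d (t : d.-tuple T) (v : 'cV[R]_d) :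
  dotv (col_of_tuple t) v = tdot t (fun l => v l 0).
Proof. by apply: eq_bigr => l _; rewrite mxE. Qed.

Lemma enorm_col_of_tuple d (t : d.-tuple T) : enorm (col_of_tuple t) ^+ 2 = nsq t.
Proof. by rewrite enorm_sqr; apply: eq_bigr => l _; rewrite mxE. Qed.

Lemma rayleighE n (A : 'M[R]_n) (al : 'cV[R]_n) :
  rayleigh A al = (\sum_(p : 'I_n * 'I_n) al p.1 0 * al p.2 0 * A p.1 p.2) /
    \sum_i al i 0 ^+ 2.
Proof.
rewrite /rayleigh enorm_sqr; congr (_ / _).
rewrite -(pair_bigA _ (fun i j => al i 0 * al j 0 * A i j)) /=.
apply: eq_bigr => i _; rewrite mxE mulr_suml; apply: eq_bigr => j _; ring.
Qed.

(** The real part of the inversion formula. *)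
Lemma fourier_transform_cos d (Phi Phihat : 'cV[R]_d -> R) (v : 'cV[R]_d) :
  fourier_transform Phi Phihat ->
  Phi v = (2 * pi) `^ (- (d%:R / 2)) *
    \int[lebesgue_tuple R d]_t
      (Phihat (col_of_tuple t) * cos (tdot t (fun l => v l 0))).
Proof.
move=> [_ /(_ v 0)]; rewrite subr0 => /(congr1 (@complex.Re R)) /=.
rewrite mul0r subr0 => ->; congr (_ * _).
rewrite /integral_Rd; apply: eq_Rintegral => t _ /=.
by rewrite mul0r subr0 dotv_tdot.
Qed.

Lemma Rintegral_weight_sum d (P : finType) (g : d.-tuple T -> R) (c : P -> R)
    (F : P -> d.-tuple T -> R) :
  (lebesgue_tuple R d).-integrable setT (EFin \o g) ->
  (forall p, measurable_fun setT (F p)) -> (forall p w, `|F p w| <= 1) ->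
  \int[lebesgue_tuple R d]_w (g w * \sum_p c p * F p w) =
  \sum_p c p * \int[lebesgue_tuple R d]_w (g w * F p w).
Proof.
move=> gi mF F1.
have iF p : (lebesgue_tuple R d).-integrable setT (EFin \o (fun w => g w * F p w)).
  exact: (integrable_weightM gi (mF p) (F1 p)).
have E p (w : d.-tuple T) : g w * (c p * F p w) = c p * (g w * F p w) by ring.
under eq_Rintegral do rewrite mulr_sumr.
rewrite (Rintegral_sum (F := fun p w => g w * (c p * F p w))).
  by apply: eq_bigr => p _; under eq_Rintegral do rewrite E; rewrite RintegralZl.
move=> p; have := integrableZl measurableT (c p) (iF p).
by apply: eq_integrable => // w _ /=; rewrite E.
Qed.

End transfer.

Theorem theorem3 (R : realType) (d : nat) (Omega : set 'cV[R]_d)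
    (k : 'cV[R]_d -> 'cV[R]_d -> R) (Phi Phihat : 'cV[R]_d -> R) (tau : R) :
  ebounded Omega ->
  translational_invariant k Phi ->
  fourier_transform Phi Phihat ->
  d%:R / 2 < tau ->
  (exists cPhi CPhi : R, [/\ 0 < cPhi, 0 < CPhi &
     forall w : 'cV[R]_d,
       cPhi * (1 + enorm w ^+ 2) `^ (- tau) <= Phihat w /\
       Phihat w <= CPhi * (1 + enorm w ^+ 2) `^ (- tau)]) ->
  exists c : R, 0 < c /\
    forall (n : nat) (x : 'I_n -> 'cV[R]_d),
      (2 <= n)%N -> injective x -> (forall i, Omega (x i)) ->
    forall b : 'cV[R]_d, b != 0 -> enorm b < c * separation_distance x ->
    forall alpha : 'cV[R]_n, alpha != 0 ->
      let K := kernel_matrix k x x in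
      let Kb := symmetric_part (kernel_matrix k (fun i => x i + b) x) in
      (3 / 4 * rayleigh K alpha <= rayleigh Kb alpha /\
       rayleigh Kb alpha < rayleigh K alpha) /\
      (1 < tau ->
       rayleigh K alpha
         - rayleigh K alpha `^ (1 - 1 / tau)
           * separation_distance x `^ (2 - d%:R / tau) <= rayleigh Kb alpha /\
       rayleigh Kb alpha < rayleigh K alpha).
Proof.
move=> [M0 OM] [_ kPhi] FT tau_gt [cP [CP [cP0 CP0 bnd]]].
have [d0|d0] := posnP d.
  exists 1; split=> // n x _ _ _ b; subst d; rewrite flatmx0 eqxx//.
pose g (t : d.-tuple (measurableTypeR R)) := Phihat (col_of_tuple t).
have gi : (lebesgue_tuple R d).-integrable setT (EFin \o g) := FT.1.
have glb t : cP * (1 + nsq t) `^ (- tau) <= g t.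
  by rewrite -enorm_col_of_tuple; exact: (bnd _).1.
have gub t : g t <= CP * (1 + nsq t) `^ (- tau).
  by rewrite -enorm_col_of_tuple; exact: (bnd _).2.
pose kappa : R := (2 * pi) `^ (- (d%:R / 2)).
have kappa0 : 0 < kappa by rewrite powR_gt0// mulr_gt0// pi_gt0.
pose D := Num.sqrt (d%:R : R).
have D1 : 1 <= D.
  by rewrite -sqrtr1 ler_sqrt ?ler0n// ler1n.
have D0 : 0 < D by apply: lt_le_trans D1.
pose H := 2 * `|M0| + 1.
have H0 : 0 < H by rewrite ltr_wpDl// mulr_ge0.
(* The value of [z] makes up for [kappa] and for the passage from [h] to [q] in
   the bound for [tau > 1]. *)
pose z := kappa `^ (1 - 1 / tau) * (D / 2) `^ (2 - d%:R / tau) / kappa.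
have D20 : 0 < D / 2 by exact: divr_gt0.
have z0 : 0 < z by rewrite divr_gt0// mulr_gt0// powR_gt0.
have [c0 c00 main] := deficit_bounds tau_gt cP0 CP0 gi glb gub H0 z0.
(* [D^-1] keeps [|b|] below [h / 2]; the other entry, as [c <= 1], gives
   [c^2 q^2 <= c0 h^2]. *)
pose c := Num.min D^-1 (4 * c0 / d%:R).
have dR0 : 0 < d%:R :> R by rewrite ltr0n.
have c_gt0 : 0 < c.
  by rewrite lt_min invr_gt0 D0/= divr_gt0// mulr_gt0.
exists c; split => // n x n2 xI xO b bn0 bq alpha an0 K Kb.
set q := separation_distance x in bq *.
have b0 : 0 < enorm b by exact: enorm_gt0.
have q0 : 0 < q by rewrite -(pmulr_rgt0 _ c_gt0); exact: lt_trans bq.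
pose h := 2 * q / D.
have h0 : 0 < h by rewrite divr_gt0// mulr_gt0.
have qM : q <= `|M0|.
  apply: separation_distance_bound => // i; apply: le_trans (ler_norm _).
  exact: OM.
have hH : h <= H.
  apply: (@le_trans _ _ (2 * q)); last by rewrite /H; lra.
  by rewrite ler_pdivrMr// ler_peMr// mulr_ge0// ltW.
pose X i l := x i l 0.
pose a i := alpha i 0.
pose B l := b l 0.
have sep : coord_separated h X.
  move=> i j ij.
  have xij : x i != x j by apply: contra ij => /eqP/xI/eqP.
  have [l hl] := exists_large_coord (x i - x j) d0; exists l.
  rewrite !mxE in hl; apply: le_trans hl.
  by rewrite ler_pM2r ?invr_gt0//; exact: separation_distance_le.
have A0 : 0 < \sum_i a i ^+ 2 by rewrite -enorm_sqr exprn_gt0// enorm_gt0.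
have bB : \sum_l B l ^+ 2 <= c0 * h ^+ 2.
  rewrite -enorm_sqr; apply: (@le_trans _ _ ((c * q) ^+ 2)).
    by rewrite lerXn2r ?nnegrE ?enorm_ge0 ?ltW// mulr_gt0.
  have -> : c0 * h ^+ 2 = 4 * c0 / d%:R * q ^+ 2.
    by rewrite /h expr_div_n sqr_sqrtr ?ler0n//; field; rewrite gt_eqF.
  rewrite exprMn ler_pM2r ?exprn_gt0// expr2.
  have c1 : c <= 1.
    by apply: (@le_trans _ _ D^-1); [rewrite ge_min lexx|rewrite invf_le1].
  have c4 : c <= 4 * c0 / d%:R by rewrite ge_min lexx orbT.
  apply: le_trans c4; rewrite ler_piMr// ltW//.
have [D4 young] := main n h X a B h0 hH sep A0 bB.
(* [b] is shorter than half of the coordinate gap [h], so the shifted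
   differences stay away from the origin as well. *)
have bh : enorm b <= h / 2.
  have -> : h / 2 = D^-1 * q by rewrite /h; field; rewrite gt_eqF.
  by apply: le_trans (ltW bq) _; rewrite ler_pM2r// ge_min lexx.
have bDh : enorm b / D <= h / 2.
  by apply: le_trans bh; rewrite ler_pdivrMr// ler_peMr// ltW.
have dpos := deficit_gt0 tau_gt cP0 gi glb (divr_gt0 b0 D0) (x := X) (a := a) (b := B).
have {}dpos := dpos _ _ A0.
set energy := \int[_]_w (g w * trigpow X a w) in D4 young.
set deficit := \int[_]_w (g w * _) in D4 young dpos.
have deficit0 : 0 < deficit.
  apply: dpos.
    move=> i j /sep[l hl]; exists l; apply: le_trans hl.
    by apply: le_trans bDh _; rewrite ler_pdivrMr// ler_peMr ?ler1n// ltW.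
  move=> i j s; case: (eqVneq i j) => [->|ij].
    have [l bl] := exists_large_coord b d0; exists l.
    by rewrite subrr add0r normrM normr_sign mul1r.
  have [l hl] := sep _ _ ij; exists l.
  apply: le_trans bDh _.
  have := coord_le_enorm b l; rewrite -/(B l) => bl.
  have : `|X i l - X j l| <= `|X i l - X j l + (-1) ^+ s * B l| + `|B l|.
    have := ler_normB (X i l - X j l + (-1) ^+ s * B l) ((-1) ^+ s * B l).
    by rewrite addrK [`|(-1) ^+ s * B l|]normrM normr_sign mul1r.
  lra.
have PhiE v : Phi v = kappa *
    \int[lebesgue_tuple R d]_t (g t * cos (tdot t (fun l => v l 0))).
  exact: fourier_transform_cos.
pose cc (p : 'I_n * 'I_n) := a p.1 * a p.2.
pose zz (p : 'I_n * 'I_n) l := X p.1 l - X p.2 l.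
have rK : rayleigh K alpha = kappa * energy / \sum_i a i ^+ 2.
  rewrite rayleighE; congr (_ / _).
  rewrite /energy /trigpow.
  rewrite (Rintegral_weight_sum cc (F := fun p w => cos (tdot w (zz p))) gi).
  - rewrite mulr_sumr; apply: eq_bigr => p _.
    rewrite mxE kPhi PhiE mulrCA; congr (_ * (_ * _)).
    by apply: eq_Rintegral => t _; congr (_ * cos _); apply: eq_bigr => l _; rewrite !mxE.
  - by move=> p; apply: measurable_cosf; exact: measurable_tdot.
  - by move=> p w; exact: cos_max.
have rKb : rayleigh Kb alpha = kappa * (energy - deficit) / \sum_i a i ^+ 2.
  rewrite rayleighE; congr (_ / _).
  have -> : energy - deficit = \int[lebesgue_tuple R d]_w
     (g w * \sum_p cc p * (cos (tdot w (zz p)) * cos (tdot w B))).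
    rewrite -RintegralB//; last 2 first.
    - exact: integrable_weight_trigpow.
    - exact: integrable_deficit.
    apply: eq_Rintegral => w _.
    rewrite -mulrBr; congr (_ * _).
    rewrite -[X in X - _]mulr1 -mulrBr opprB addrC subrK /trigpow mulr_suml.
    by apply: eq_bigr => p _; rewrite mulrA.
  have mzz p : measurable_fun setT (fun w => cos (tdot w (zz p)) : R).
    by apply: measurable_cosf; exact: measurable_tdot.
  have mB : measurable_fun setT (fun w => cos (tdot w B) : R).
    by apply: measurable_cosf; exact: measurable_tdot.
  rewrite (Rintegral_weight_sum cc (F := fun p w => cos (tdot w (zz p)) * cos (tdot w B)) gi).
  - rewrite mulr_sumr; apply: eq_bigr => p _.
    rewrite !mxE !kPhi !PhiE.
    have icos v : (lebesgue_tuple R d).-integrable setT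
        (EFin \o (fun t => g t * cos (tdot t v))).
      apply: (integrable_weightM gi (M := 1)) => [|w]; last exact: cos_max.
      by apply: measurable_cosf; exact: measurable_tdot.
    set v1 := fun l => (x p.1 + b - x p.2) l 0.
    set v2 := fun l => (x p.2 + b - x p.1) l 0.
    have -> : \int[lebesgue_tuple R d]_w
        (g w * (cos (tdot w (zz p)) * cos (tdot w B))) =
        2^-1 * \int[lebesgue_tuple R d]_w (g w * cos (tdot w v1)) +
        2^-1 * \int[lebesgue_tuple R d]_w (g w * cos (tdot w v2)).
      rewrite -Rintegral_lin2//; apply: eq_Rintegral => w _.
      have -> : tdot w v1 = tdot w (zz p) + tdot w B.
        by rewrite /tdot -big_split; apply: eq_bigr => l _; rewrite /v1 !mxE /zz /X /B /=; ring.
      have -> : tdot w v2 = tdot w B - tdot w (zz p).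
        by rewrite /tdot -sumrB; apply: eq_bigr => l _; rewrite /v2 !mxE /zz /X /B /=; ring.
      by rewrite cosB cosD; field.
    rewrite /cc /a; ring.
  - by move=> p; exact: measurable_funM.
  - by move=> p w; rewrite normrM mulr_ile1// cos_max.
set A := \sum_i a i ^+ 2 in A0 rK rKb young.
have lt_main : rayleigh Kb alpha < rayleigh K alpha.
  by rewrite rK rKb ltr_pM2r ?invr_gt0// ltr_pM2l// gtrBl.
split; [split => //|move=> tau1; split => //].
  rewrite rK rKb mulrA ler_pM2r ?invr_gt0// mulrCA ler_pM2l//; lra.
have eA0 : 0 <= energy / A.
  apply: divr_ge0; last exact: ltW.
  apply: Rintegral_ge0 => w _.
  by rewrite mulr_ge0 ?trigpow_ge0// (weight_ge0 cP0 glb).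
have qhD : q = h * (D / 2) by rewrite /h; field; rewrite gt_eqF.
rewrite rK rKb -mulrA qhD (powRM _ (ltW kappa0) eA0) (powRM _ (ltW h0) (ltW D20)).
have := ler_wpM2l (ltW kappa0) (young tau1); set Y := _ `^ _ * h `^ _.
have -> : kappa * (z * Y) = kappa `^ (1 - 1 / tau) * (energy / A) `^ (1 - 1 / tau) *
    (h `^ (2 - d%:R / tau) * (D / 2) `^ (2 - d%:R / tau)).
  by rewrite /z /Y; field; rewrite gt_eqF.
have -> : kappa * (energy - deficit) / A = kappa * (energy / A) - kappa * (deficit / A).
  by rewrite -mulrA mulrBl mulrBr.
by rewrite lerD2l lerN2.
Qed.
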